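(* Consider the linear system with additive noise $$dx(t)=[Ax(t)+B_1u(t)]\,dt+B_2\,dM(t),\quad x(0)=0,\qquad y(t)=Cx(t),\quad t\ge0,$$ and the reduced system $$d\hat x(t)=[\hat A\hat x(t)+\hat B_1u(t)]\,dt+\hat B_2\,dM(t),\quad \hat x(0)=0,\qquad \hat y(t)=\hat C\hat x(t),\quad t\ge0,$$ with the same control $u$ and noise $M$. Suppose that all eigenvalues of $A$ and $\hat A$ have negative real part. Let $\mathcal W=\begin{bmatrix}I&0\\0&K^{1/2}\end{bmatrix}$ with $I$ the $m_1\times m_1$ identity matrix. Then, for every $T>0$, $$\sup_{t\in[0,T]}\mathbb E\left\|y(t)-\hat y(t)\right\|\le\sqrt2\,\left\|Ce^{A\cdot}\begin{bmatrix}B_1&B_2\end{bmatrix}-\hat Ce^{\hat A\cdot}\begin{bmatrix}\hat B_1&\hat B_2\end{bmatrix}\right\|_{\mathcal L^2(\mathcal W)}\max\{1,\left\|u\right\|_{L^2_T}\}.$$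
   Context: Matrices: $A\in\mathbb R^{n\times n}$, $B_1\in\mathbb R^{n\times m_1}$, $B_2\in\mathbb R^{n\times m_2}$, $C\in\mathbb R^{p\times n}$, $\hat A\in\mathbb R^{r\times r}$, $\hat B_1\in\mathbb R^{r\times m_1}$, $\hat B_2\in\mathbb R^{r\times m_2}$, $\hat C\in\mathbb R^{p\times r}$. Noise: $(\Omega,\mathcal F,(\mathcal F_t)_{t\ge0},\mathbb P)$ is a filtered probability space with right-continuous and complete filtration. $M$ is an $\mathbb R^{m_2}$-valued square integrable Lévy process with mean zero, $(\mathcal F_t)$-adapted, with $M(t+h)-M(t)$ independent of $\mathcal F_t$ for $t,h\ge0$, and covariance matrix $K$, i.e. $\mathbb E[M(t)M^T(t)]=Kt$; $K^{1/2}$ is its symmetric positive semidefinite square root. Control: $u$ is an $\mathbb R^{m_1}$-valued $(\mathcal F_t)$-adapted process with $\|u\|_{L^2_T}^2:=\mathbb E\int_0^T\|u(s)\|^2ds<\infty$ for all $T>0$ ($\|\cdot\|$ the Euclidean norm). Norm: for a (deterministic) matrix-valued function $Y$ on $[0,\infty)$ and a square matrix $\mathcal W$ of matching size, $\|Y\|^2_{\mathcal L^2(\mathcal W)}:=\int_0^\infty\|Y(s)\mathcal W\|_F^2\,ds$, with $\|\cdot\|_F$ the Frobenius norm. $Ce^{A\cdot}B$ denotes the function $s\mapsto Ce^{As}B$. *)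

(* Defs.v *)
From HB Require Import structures.
From mathcomp Require Export all_boot all_order all_algebra.
From mathcomp Require Export all_classical all_reals all_analysis.
From mathcomp Require Export complex.

Set Implicit Arguments.
Unset Strict Implicit.
Unset Printing Implicit Defensive.

Export Order.TTheory GRing.Theory Num.Theory.
Export numFieldNormedType.Exports.

Local Open Scope classical_set_scope.
Local Open Scope ring_scope.

Section matrices.
Context {R : realType}.

(* On a column vector this is the Euclidean norm. *)
Definition frob m n (A : 'M[R]_(m, n)) : R :=
  Num.sqrt (\sum_i \sum_j A i j ^+ 2).

Definition expmx n (A : 'M[R]_n) : 'M[R]_n :=
  limn (series (fun k => (k`!%:R)^-1 *: A ^+ k)).

(* The eigenvalues of a real matrix are taken in the complex field R[i]. *)
Definition hurwitz n (A : 'M[R]_n) : Prop :=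
  forall l : R[i], eigenvalue (map_mx (real_complex R) A) l ->
    complex.Re l < 0.

Definition psd n (S : 'M[R]_n) : Prop :=
  S^T = S /\ forall v : 'cV[R]_n, 0 <= (v^T *m S *m v) 0 0.

Definition psd_sqrt n (S K : 'M[R]_n) : Prop := psd S /\ S *m S = K.

Definition L2norm_weighted p q (Y : R -> 'M[R]_(p, q)) (W : 'M[R]_q) : \bar R :=
  sqrte (\int[lebesgue_measure]_(s in `[0%R, +oo[) ((frob (Y s *m W)) ^+ 2)%:E).

End matrices.

Section processes.
Context {R : realType} {d : measure_display} {Omega : measurableType d}.
Variable P : probability Omega R.

(* Time runs over [0, +oo[: filtrations and processes are total functions of
   t : R, and only their values at t >= 0 are ever constrained or used. *)
Implicit Types (F : R -> set_system Omega).

Definition usual_filtration F : Prop :=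
  [/\ forall t : R, 0 <= t -> sigma_algebra setT (F t) /\ F t `<=` measurable,
      forall s t : R, 0 <= s -> s <= t -> F s `<=` F t,
      forall t : R, 0 <= t -> \bigcap_(s in `]t, +oo[) F s `<=` F t
    & forall N, P.-negligible N -> F 0 N].

Definition borel_sets m : set_system 'cV[R]_m := <<s @open 'cV[R]_m >>.

Definition adapted F m (X : R -> Omega -> 'cV[R]_m) : Prop :=
  forall t : R, 0 <= t -> forall B, borel_sets B -> F t (X t @^-1` B).

(* Joint measurability in (t, w), so that iterated integrals over time and
   Omega, and the pathwise time integrals, are meaningful. *)
Definition jointly_measurable m (X : R -> Omega -> 'cV[R]_m) : Prop :=
  forall B, borel_sets B ->
    @measurable _ (measurableTypeR R * Omega)%type
      [set z | 0 <= z.1 /\ B (X z.1 z.2)].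

Definition incr m (M : R -> Omega -> 'cV[R]_m) (t h : R) : Omega -> 'cV[R]_m :=
  fun w => M (t + h) w - M t w.

(* Levy process relative to F: independence of M (t + h) - M t from F t,
   together with adaptedness, contains the independence of the increments.
   Regularity in time is stochastic continuity; cadlag paths are not required
   (a cadlag M satisfies this definition). *)
Definition levy_process F m (M : R -> Omega -> 'cV[R]_m) : Prop :=
  [/\ adapted F M,
      {ae P, forall w, M 0 w = 0},
      forall t h : R, 0 <= t -> 0 <= h ->
        forall E B, F t E -> borel_sets B ->
          P (E `&` incr M t h @^-1` B) = (P E * P (incr M t h @^-1` B))%E,
      forall t h : R, 0 <= t -> 0 <= h -> forall B, borel_sets B ->
        P (incr M t h @^-1` B) = P (incr M 0 h @^-1` B)
    & forall t e : R, 0 <= t -> 0 < e ->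
        P [set w | e < frob (M s w - M t w)] @[s --> within `[0, +oo[ (nbhs t)]
          --> 0%E].

Definition square_integrable m (M : R -> Omega -> 'cV[R]_m) : Prop :=
  forall t : R, 0 <= t -> (\int[P]_w ((frob (M t w)) ^+ 2)%:E < +oo)%E.

Definition mean_zero m (M : R -> Omega -> 'cV[R]_m) : Prop :=
  forall (t : R) i, 0 <= t -> ('E_P[fun w => M t w i ord0] = 0)%E.

Definition covariance_matrix m (M : R -> Omega -> 'cV[R]_m) (K : 'M[R]_m) :=
  forall (t : R) i j, 0 <= t ->
    ('E_P[fun w => (M t w *m (M t w)^T)%R i j] = (K i j * t)%:E)%E.

Definition L2T_norm (T : R) m (u : R -> Omega -> 'cV[R]_m) : \bar R :=
  sqrte (\int[P]_w \int[lebesgue_measure]_(s in `[0%R, T])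
           ((frob (u s w)) ^+ 2)%:E).

Definition control F m (u : R -> Omega -> 'cV[R]_m) : Prop :=
  [/\ adapted F u, jointly_measurable u
    & forall T : R, 0 < T -> (L2T_norm T u < +oo)%E].

(* dx = (A x + B1 u) dt + B2 dM, x 0 = 0, in integrated form; since B2 is
   constant, the stochastic integral of B2 over [0, t] is B2 (M t - M 0).
   The equation is required almost surely for each t; a cadlag solution, for
   which it holds for all t simultaneously, is a particular case. *)
Definition solution F n m1 m2 (A : 'M[R]_n) (B1 : 'M[R]_(n, m1))
    (B2 : 'M[R]_(n, m2)) (u : R -> Omega -> 'cV[R]_m1)
    (M : R -> Omega -> 'cV[R]_m2) (x : R -> Omega -> 'cV[R]_n) : Prop :=
  let drift s w := A *m x s w + B1 *m u s w in
  [/\ adapted F x, jointly_measurable x,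
      {ae P, forall w, x 0 w = 0},
      {ae P, forall w, forall (t : R) i, 0 <= t ->
        lebesgue_measure.-integrable `[0, t] (fun s => (drift s w i 0)%:E)}
    & forall t : R, 0 <= t -> {ae P, forall w,
        x t w = (\col_i \int[lebesgue_measure]_(s in `[0, t]) (drift s w i 0))
                + B2 *m (M t w - M 0 w)}].

End processes.

(* Main.v *)
From HB Require Import structures.
Require Import Defs.
From mathcomp Require Import measurable_realfun ring lra.

(** Fix t in [0, T], a row c of the output matrix, and let phi s = c exp ((t - s) A),
    so that phi' = - phi A.  Let D be the integrated drift of a path and N = x - D;
    for each time N is almost surely the noise term B2 (M s - M 0).  Integration by
    parts along the path ([variation_of_constants]) gives
<<
      c x t = int_0^t phi B1 u ds + (phi t N t - int_0^t phi' N ds),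
>>
    and the bracket is the stochastic integral of phi B2 against M.  It is never
    constructed: the bracket is compared with the left-point sums of phi B2 against
    the increments of M.  By summation by parts ([discretization_error]) the
    difference is an integral of phi' against increments of the noise over one
    cell of the grid, whose mean tends to 0 with the mesh ([system_error]).

    Two facts about M are used.  Independence of M (t + h) - M t from the past
    gives E (M_i s M_j t) = K_ij min (s, t) ([levy_cov]), hence an exact formula for
    the second moment of the left-point sums ([levy_sum_sqr]); and the mean absolute
    increment over a time h is O(sqrt h).

    Write G1 and G2 for the differences of the impulse responses of the two systems
    with respect to u and to M.  The same subtraction for the two systems bounds
    E |y t - yh t| by three terms.  The control contributes at most
    |G1|_(L^2(0, t)) times the L^2 norm of u, by Cauchy-Schwarz.  The noise
    contributes the square root of a Riemann sum for the integral over [0, t] of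
    |G2 sqrtK|_F^2.  The third term vanishes as the mesh tends to 0
    ([fixed_time_bound]).  Finally the square of the weighted norm of the impulse
    response is at least the integral over [0, t] of
    |G1|_F^2 + |G2 sqrtK|_F^2 ([energy_weighted_le]), and
    sqrt a + sqrt b <= sqrt 2 sqrt (a + b). *)

Set Implicit Arguments.
Unset Strict Implicit.
Unset Printing Implicit Defensive.

Local Open Scope classical_set_scope.
Local Open Scope ring_scope.

(** * The Euclidean and Frobenius norm *)

Section euclid.
Context {R : realType}.

(** The converse of the weighted inequality 2 a b <= l a^2 + b^2 / l: having it
    for every weight l is as good as Cauchy-Schwarz.  All Cauchy-Schwarz
    inequalities below come from it, since the weighted form can be proved
    pointwise and then summed or integrated. *)
Lemma le_sqrt_of_amgm (a al be : R) : 0 <= al -> 0 <= be ->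
  (forall l : R, 0 < l -> 2 * a <= l * al + l^-1 * be) ->
  a <= Num.sqrt al * Num.sqrt be.
Proof.
move=> al0 be0 H; rewrite leNgt; apply/negP => lt_a.
have a0 : 0 < a by apply: le_lt_trans lt_a; rewrite mulr_ge0 ?sqrtr_ge0.
have aa : al * be < a * a.
  rewrite -[al]sqr_sqrtr// -[be]sqr_sqrtr// -exprMn -expr2.
  by rewrite ltr_pXn2r ?nnegrE// ?mulr_ge0 ?sqrtr_ge0 ?ltW.
(* The optimal weight is a / al; if al = 0 any large weight contradicts lt_a. *)
have [alz|alnz] := eqVneq al 0.
  have be1 : 0 < be + 1 by lra.
  have l0 : 0 < (be + 1) / a by rewrite divr_gt0.
  have := H _ l0; rewrite alz mulr0 add0r invf_div.
  have : a / (be + 1) * be <= a.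
    rewrite mulrAC ler_pdivrMr// ler_wpM2l//; lra.
  lra.
have alp : 0 < al by rewrite lt_def alnz.
have := H (a / al) (divr_gt0 a0 alp).
rewrite mulfVK// invf_div => H2.
have : al / a * be < a by rewrite mulrAC ltr_pdivrMr.
lra.
Qed.

Lemma frob_ge0 m n (A : 'M[R]_(m, n)) : 0 <= frob A.
Proof. exact: sqrtr_ge0. Qed.

Lemma sqr_frob m n (A : 'M[R]_(m, n)) : frob A ^+ 2 = \sum_i \sum_j A i j ^+ 2.
Proof.
by rewrite sqr_sqrtr// sumr_ge0// => i _; rewrite sumr_ge0// => j _; exact: sqr_ge0.
Qed.

Lemma sqr_frob_col m (v : 'cV[R]_m) : frob v ^+ 2 = \sum_i v i 0 ^+ 2.
Proof. by rewrite sqr_frob; apply: eq_bigr => i _; rewrite big_ord1. Qed.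

Lemma frob_le_sqr m n (A : 'M[R]_(m, n)) b : 0 <= b ->
  \sum_i \sum_j A i j ^+ 2 <= b ^+ 2 -> frob A <= b.
Proof.
by move=> b0; rewrite -sqr_frob ler_pXn2r// nnegrE// frob_ge0.
Qed.

(** Cauchy-Schwarz for the Frobenius inner product. *)
Lemma sum_mul_le_frob m n (A B : 'M[R]_(m, n)) :
  \sum_i \sum_j A i j * B i j <= frob A * frob B.
Proof.
have sq0 (D : 'M[R]_(m, n)) : 0 <= \sum_i \sum_j D i j ^+ 2.
  by rewrite -sqr_frob sqr_ge0.
apply: le_sqrt_of_amgm => // l l0.
rewrite !mulr_sumr -big_split; apply: ler_sum => i _ /=.
rewrite !mulr_sumr -big_split; apply: ler_sum => j _ /=.
rewrite -subr_ge0.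
have -> : l * A i j ^+ 2 + l^-1 * B i j ^+ 2 - 2 * (A i j * B i j) =
    l^-1 * (l * A i j - B i j) ^+ 2 by field; rewrite gt_eqF.
by rewrite mulr_ge0 ?sqr_ge0// invr_ge0 ltW.
Qed.

Lemma frobD m n (A B : 'M[R]_(m, n)) : frob (A + B) <= frob A + frob B.
Proof.
apply: frob_le_sqr; first by rewrite addr_ge0 ?frob_ge0.
rewrite sqrrD !sqr_frob.
under eq_bigr do under eq_bigr do rewrite mxE sqrrD.
under eq_bigr do rewrite !big_split/=.
rewrite !big_split/= lerD2r lerD2l.
by rewrite -mulr2n lerMn2r sum_mul_le_frob.
Qed.

Lemma frob_col_le_sum m (v : 'cV[R]_m) : frob v <= \sum_i `|v i 0|.
Proof.
apply: frob_le_sqr; first by rewrite sumr_ge0.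
under eq_bigr do rewrite big_ord1.
rewrite expr2 mulr_suml; apply: ler_sum => i _.
rewrite -real_normK ?num_real// expr2 ler_wpM2l//.
by rewrite (bigD1 i)//= lerDl sumr_ge0.
Qed.

End euclid.

(** * The matrix exponential *)

Section expmx.
Context {R : realType} {n : nat}.
Implicit Types A B : 'M[R]_n.

Let l1 B : R := \sum_i \sum_j `|B i j|.

Let l1_ge0 B : 0 <= l1 B.
Proof. by rewrite sumr_ge0// => i _; rewrite sumr_ge0. Qed.

Let le_l1 B i j : `|B i j| <= l1 B.
Proof.
rewrite /l1 (bigD1 i)//= (bigD1 j)//= -addrA lerDl addr_ge0// ?sumr_ge0//.
by move=> k _; rewrite sumr_ge0.
Qed.

Let l1M A B : l1 (A *m B) <= l1 A * l1 B.
Proof.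
rewrite /l1 mulr_suml; apply: ler_sum => i _.
apply: (@le_trans _ _ (\sum_j \sum_k `|A i k| * `|B k j|)).
  apply: ler_sum => j _; rewrite mxE; apply: le_trans (ler_norm_sum _ _ _) _.
  by apply: ler_sum => k _; rewrite normrM.
rewrite exchange_big/= mulr_suml; apply: ler_sum => k _.
rewrite -mulr_sumr ler_wpM2l//.
by rewrite [leRHS](bigD1 k)//= lerDl sumr_ge0// => i' _; rewrite sumr_ge0.
Qed.

(** The entry (i, j) of exp (s A) B is a power series in s with these
    coefficients.  Carrying the right factor B makes the family stable under
    formal differentiation, which multiplies B by A on the left. *)
Let coef A B i j (k : nat) : R := k`!%:R^-1 * (A ^+ k *m B) i j.

Let l1_exp A B k : l1 (A ^+ k *m B) <= l1 A ^+ k * l1 B.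
Proof.
elim: k B => [|k IH] B; first by rewrite !expr0 mul1mx mul1r.
rewrite exprS -mulmxE -mulmxA exprS -mulrA.
by apply: le_trans (l1M _ _) _; rewrite ler_wpM2l.
Qed.

(** Domination by the scalar exponential series at |A|_1 |s|, the entrywise l1 norm
    being submultiplicative. *)
Let coef_cvg A B i j (s : R) : cvgn (pseries (coef A B i j) s).
Proof.
apply: normed_cvg.
apply: (@series_le_cvg _ _ (fun k => l1 B *: exp_coeff (l1 A * `|s|) k)) => //.
- by move=> k; rewrite /=.
- by move=> k; rewrite /GRing.scale/= mulr_ge0// exp_coeff_ge0// mulr_ge0.
- move=> k; rewrite /coef/=. rewrite !normrM normrX. rewrite (@ger0_norm _ k`!%:R^-1) ?invr_ge0//.
  rewrite [leLHS](_ : _ = k`!%:R^-1 * `|s| ^+ k * `|(A ^+ k *m B) i j|);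
    last by ring.
  rewrite [leRHS](_ : _ = k`!%:R^-1 * `|s| ^+ k * (l1 A ^+ k * l1 B)); last first.
    by rewrite /GRing.scale/exp_coeff/= exprMn; ring.
  rewrite ler_wpM2l ?mulr_ge0 ?invr_ge0 ?exprn_ge0//.
  exact: le_trans (le_l1 _ i j) (l1_exp A B k).
- by apply: is_cvg_seriesZ; exact: is_cvg_series_exp_coeff.
Qed.

Let coef_diffs A B i j : pseries_diffs (coef A B i j) = coef A (A *m B) i j.
Proof.
apply/funext => k; rewrite /pseries_diffs /coef factS natrM.
rewrite exprSr -mulmxE mulmxA invfM !mulrA mulfV ?mul1r//.
Qed.

Let expZmx (s : R) A k : (s *: A) ^+ k = s ^+ k *: (A ^+ k).
Proof.
elim: k => [|k IH]; first by rewrite !expr0 scale1r.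
by rewrite !exprS IH -!mulmxE -scalemxAl -scalemxAr scalerA.
Qed.

(** Convergence of matrices is entrywise, so the limit defining the exponential
    is computed entry by entry. *)
Lemma expmx_entry A s i j :
  expmx (s *: A) i j = limn (pseries (coef A 1%:M i j) s).
Proof.
have E N k l : series (fun k => (k`!%:R)^-1 *: (s *: A) ^+ k) N k l =
    pseries (coef A 1%:M k l) s N.
  rewrite /pseries/series/= summxE; apply: eq_bigr => q _.
  rewrite /coef mulmx1 expZmx mxE mxE; ring.
pose L : 'M[R]_n := \matrix_(k, l) limn (pseries (coef A 1%:M k l) s).
suff : series (fun k => (k`!%:R)^-1 *: (s *: A) ^+ k) @ \oo --> L.
  move=> /cvg_lim; rewrite /expmx => ->.
    by rewrite mxE.
  exact: (@norm_hausdorff R ('M[R]_n : pseudoMetricNormedZmodType R)).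
apply/cvgrPdist_le => e e0.
have H (kl : 'I_n * 'I_n) : \forall N \near \oo,
    `|limn (pseries (coef A 1%:M kl.1 kl.2) s) -
      pseries (coef A 1%:M kl.1 kl.2) s N| <= e.
  by apply: (cvgrPdist_le _ _).1 => //; exact: coef_cvg.
have {H} : \forall N \near \oo, forall kl : 'I_n * 'I_n,
    `|limn (pseries (coef A 1%:M kl.1 kl.2) s) -
      pseries (coef A 1%:M kl.1 kl.2) s N| <= e.
  exact: filter_forall.
apply: filterS => N HN.
rewrite [X in X <= _]mx_normrE; apply: bigmax_le; first exact: ltW.
by move=> kl _; rewrite 3!mxE E; exact: HN.
Qed.

Let coef_mulr A B s i j :
  limn (pseries (coef A B i j) s) = (expmx (s *: A) *m B) i j.
Proof.
rewrite mxE; apply: cvg_lim => //.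
under eq_bigr do rewrite expmx_entry.
have -> : pseries (coef A B i j) s = fun N =>
   \sum_k pseries (coef A 1%:M i k) s N * B k j.
  apply/funext => N; rewrite /pseries/series/=.
  under [RHS]eq_bigr do rewrite mulr_suml.
  rewrite exchange_big/=; apply: eq_bigr => q _.
  rewrite /coef mxE mulr_sumr mulr_suml; apply: eq_bigr => k _.
  by rewrite mulmx1; ring.
apply: cvg_big; first exact: add_continuous.
by move=> k _; apply: cvgM; [exact: coef_cvg|exact: cvg_cst].
Qed.

(** Termwise differentiation of the power series of each entry. *)
Lemma is_derive_expmx A s i j :
  is_derive s (1 : R) (fun s => expmx (s *: A) i j) ((expmx (s *: A) *m A) i j).
Proof.
under eq_fun do rewrite expmx_entry.
rewrite -coef_mulr.
have -> : coef A A i j = pseries_diffs (coef A 1%:M i j).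
  by rewrite coef_diffs mulmx1.
apply: (@pseries_snd_diffs _ _ (`|s| + 1)); rewrite ?coef_diffs; try exact: coef_cvg.
by rewrite [ltRHS]ger0_norm ?addr_ge0// ltrDl.
Qed.

Lemma expmx0 A : expmx (0 *: A) = 1%:M.
Proof.
apply/matrixP => i j; rewrite expmx_entry; apply: cvg_lim => //.
have -> : 1%:M i j = coef A 1%:M i j 0%N by rewrite /coef fact0 invr1 mul1r mulmx1.
apply: cvg_near_cst; exists 1%N => // N /= N1.
rewrite /pseries/series/= -(prednK N1) big_nat_recl//= expr0 mulr1 big1 ?addr0//.
by move=> k _; rewrite expr0n/= mulr0.
Qed.

End expmx.

(** * Continuously differentiable functions *)

Section C1.
Context {R : realType}.
Implicit Types f g : R -> R.

Definition C1 f := exists2 f' : R -> R, continuous f' &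
  forall s, is_derive s (1 : R) f (f' s).

Lemma is_derive_cont f (f' : R -> R) :
  (forall s, is_derive s (1 : R) f (f' s)) -> continuous f.
Proof.
by move=> H s; apply/differentiable_continuous/derivable1_diffP; have [] := H s.
Qed.

Lemma C1_cont f : C1 f -> continuous f.
Proof. by move=> [f' _ /is_derive_cont]. Qed.

Lemma C1_cst (a : R) : C1 (fun=> a).
Proof.
by exists (fun=> 0) => [|s]; [exact: cst_continuous|exact: is_derive_cst].
Qed.

Lemma C1D f g : C1 f -> C1 g -> C1 (fun s => f s + g s).
Proof.
move=> [f' cf df] [g' cg dg]; exists (fun s => f' s + g' s).
  by move=> s; apply: cvgD; [exact: cf|exact: cg].
by move=> s; exact: is_deriveD.
Qed.

Lemma C1M f g : C1 f -> C1 g -> C1 (fun s => f s * g s).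
Proof.
move=> C1f C1g; have cf0 := C1_cont C1f; have cg0 := C1_cont C1g.
case: C1f C1g => [f' cf df] [g' cg dg].
exists (fun s => f s * g' s + g s * f' s).
  move=> s; apply: cvgD; apply: cvgM.
  - exact: cf0.
  - exact: cg.
  - exact: cg0.
  - exact: cf.
by move=> s; exact: is_deriveM.
Qed.

Lemma C1N f : C1 f -> C1 (fun s => - f s).
Proof.
move=> C1f; have := C1M (C1_cst (-1)) C1f.
by congr C1; apply/funext => s; rewrite mulN1r.
Qed.

Lemma C1_sum I (r : seq I) (P : pred I) (F : I -> R -> R) :
  (forall i, C1 (F i)) -> C1 (fun s => \sum_(i <- r | P i) F i s).
Proof.
move=> H; elim: r => [|i r IH].
  by under eq_fun do rewrite big_nil; exact: C1_cst.
under eq_fun do rewrite big_cons.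
by case: (P i) => //; apply: C1D.
Qed.

Lemma C1_refl (t : R) f : C1 f -> C1 (fun s => f (t - s)).
Proof.
move=> [f' cf df]; exists (fun s => - f' (t - s)).
  move=> s; apply: cvgN; apply: (@continuous_comp _ _ _ (fun s => t - s) f').
    by apply: cvgB; [exact: cvg_cst|exact: cvg_id].
  exact: cf.
move=> s; have h : is_derive s (1 : R) (fun s : R => t - s) (-1).
  by apply: is_derive_eq; rewrite add0r mul1r.
have := @is_derive1_comp _ f (fun s : R => t - s) s _ _ (df _) h.
by rewrite mulrN1.
Qed.

Lemma mulmx_entry_C1 m n p (X : R -> 'M[R]_(m, n)) (Y : R -> 'M[R]_(n, p)) :
  (forall i j, C1 (fun s => X s i j)) -> (forall i j, C1 (fun s => Y s i j)) ->
  forall i j, C1 (fun s => (X s *m Y s) i j).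
Proof.
move=> HX HY i j; under eq_fun do rewrite mxE.
by apply: C1_sum => k; exact: C1M.
Qed.

Lemma expmx_C1 n (A : 'M[R]_n) i j : C1 (fun s => expmx (s *: A) i j).
Proof.
exists (fun s => (expmx (s *: A) *m A) i j); last first.
  by move=> s; exact: is_derive_expmx.
under eq_fun do rewrite mxE.
apply: continuous_big; first exact: add_continuous.
move=> k _ s; apply: cvgM; last exact: cvg_cst.
by apply: (is_derive_cont (fun s => is_derive_expmx A s i k)).
Qed.

Lemma continuous_bounded f (t : R) : 0 <= t -> continuous f ->
  exists2 L, 0 <= L & forall s, 0 <= s <= t -> `|f s| <= L.
Proof.
move=> t0 cf.
have cn : {within `[0, t], continuous (fun s => `|f s|)}.
  apply: continuous_subspaceT => s.
  by apply: (@continuous_comp _ _ _ f (fun x => `|x|)); [exact: cf|exact: norm_continuous].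
have [c _ H] := EVT_max t0 cn.
by exists `|f c| => // s st; apply: H; rewrite in_itv.
Qed.

Lemma C1_lipschitz f (t : R) : 0 <= t -> C1 f ->
  exists2 L, 0 <= L & forall x y, 0 <= x <= t -> 0 <= y <= t ->
    `|f x - f y| <= L * `|x - y|.
Proof.
move=> t0 C1f; have cf := C1_cont C1f; case: C1f => f' cf' df.
have [L L0 H] := continuous_bounded t0 cf'.
exists L => //.
suff K x y : 0 <= x <= t -> 0 <= y <= t -> x <= y -> `|f x - f y| <= L * `|x - y|.
  move=> x y xt yt; have [|/ltW] := leP x y; first exact: K.
  by move=> yx; rewrite distrC (distrC x); exact: K.
move=> /andP[x0 xt] /andP[y0 yt] xy.
have [c /[!in_itv]/= /andP[xc cy] E] : exists2 c, c \in `[x, y] &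
    f y - f x = f' c * (y - x).
  by apply: MVT_segment => //; exact: continuous_subspaceT.
rewrite distrC E normrM (distrC x) ler_wpM2r// H//.
by rewrite (le_trans x0)//= (le_trans cy).
Qed.

End C1.

(** * Integrals over intervals and Riemann sums *)

Section intervals.
Context {R : realType}.
Implicit Types f g : R -> R.
Notation mu := (@lebesgue_measure R).

Lemma continuous_integrable f (a b : R) :
  continuous f -> mu.-integrable `[a, b] (EFin \o f).
Proof.
move=> cf; apply: continuous_compact_integrable; first exact: segment_compact.
exact: continuous_subspaceT.
Qed.

Lemma integrable_sub_itv f (a b c d : R) : a <= c -> d <= b ->
  mu.-integrable `[a, b] (EFin \o f) -> mu.-integrable `[c, d] (EFin \o f).
Proof.
move=> ac db; apply: integrableS => //.
by apply: subset_itv; rewrite bnd_simp.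
Qed.

Lemma continuous_mul_integrable f g (a b : R) :
  continuous f -> mu.-integrable `[a, b] (EFin \o g) ->
  mu.-integrable `[a, b] (EFin \o (fun s => f s * g s)).
Proof.
move=> cf ig.
have := @integrableMr _ _ _ mu `[a, b] (measurable_itv _) f (EFin \o g) _ _ ig.
apply.
  by apply: measurable_funTS; exact: continuous_measurable_fun.
have /compact_bounded[M [Mr HM]] : compact (f @` `[a, b]).
  apply: continuous_compact; last exact: segment_compact.
  exact: continuous_subspaceT.
by exists M; split=> // x Mx s sab; apply: HM => //; exists s.
Qed.

Lemma Rintegral_FTC f (f' : R -> R) (a b : R) : a <= b ->
  continuous f' -> (forall s, is_derive s (1 : R) f (f' s)) ->
  \int[mu]_(s in `[a, b]) f' s = f b - f a.
Proof.
move=> ab cf' df; have cf := is_derive_cont df.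
move: ab; rewrite le_eqVlt => /predU1P[<-|ab].
  by rewrite subrr set_itv1 Rintegral_set1.
rewrite /Rintegral (@continuous_FTC2 _ f' f)//.
- exact: continuous_subspaceT.
- split; [by move=> x _; have [] := df x|..].
  + exact/cvg_at_right_filter/cf.
  + exact/cvg_at_left_filter/cf.
- by move=> x _; rewrite derive1E; have := df x => ?; exact: derive_val.
Qed.

Lemma Rintegral_itv_split f (a b c : R) : a <= b -> b <= c ->
  mu.-integrable `[a, c] (EFin \o f) ->
  \int[mu]_(s in `[a, c]) f s =
  \int[mu]_(s in `[a, b]) f s + \int[mu]_(s in `[b, c]) f s.
Proof.
move=> ab bc fi.
rewrite -(Rintegral_itv_obnd_cbnd (r := b)); last first.
  apply: integrableS fi => //.
  by apply: subset_itv; rewrite bnd_simp.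
by rewrite -(Rintegral_itvB fi) ?bnd_simp// addrC subrK.
Qed.

Definition grid (t : R) (n i : nat) : R := t * (i%:R / n%:R).

Lemma grid0 t n : grid t n 0 = 0.
Proof. by rewrite /grid mul0r mulr0. Qed.

Lemma gridn t n : (0 < n)%N -> grid t n n = t.
Proof. by move=> n0; rewrite /grid divff ?mulr1// pnatr_eq0 -lt0n. Qed.

Lemma le_grid t n i j : 0 <= t -> (i <= j)%N -> grid t n i <= grid t n j.
Proof. by move=> t0 ij; rewrite ler_wpM2l// ler_wpM2r ?invr_ge0// ler_nat. Qed.

Lemma grid_ge0 t n i : 0 <= t -> 0 <= grid t n i.
Proof. by move=> t0; rewrite -(grid0 t n) le_grid. Qed.

Lemma grid_le t n i : 0 <= t -> (0 < n)%N -> (i <= n)%N -> grid t n i <= t.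
Proof. by move=> t0 n0 ni; rewrite -[leRHS](gridn t n0) le_grid. Qed.

Lemma gridS t n i : grid t n i.+1 - grid t n i = t / n%:R.
Proof. by rewrite /grid -mulrBr -mulrBl -natr1 addrAC subrr add0r mul1r. Qed.

Lemma Rintegral_grid f t n : 0 <= t -> (0 < n)%N ->
  mu.-integrable `[0, t] (EFin \o f) ->
  \int[mu]_(s in `[0, t]) f s =
  \sum_(i < n) \int[mu]_(s in `[grid t n i, grid t n i.+1]) f s.
Proof.
move=> t0 n0 fi.
suff H m : (m <= n)%N -> \int[mu]_(s in `[0, grid t n m]) f s =
    \sum_(i < m) \int[mu]_(s in `[grid t n i, grid t n i.+1]) f s.
  by rewrite -H ?gridn.
elim: m => [|m IH] mn.
  by rewrite big_ord0 grid0 set_itv1 Rintegral_set1.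
rewrite big_ord_recr/= -IH; last exact: ltnW.
apply: Rintegral_itv_split.
- exact: grid_ge0.
- exact: le_grid.
- by apply: integrable_sub_itv fi => //; exact: grid_le.
Qed.

(** A function of class C1 is Lipschitz on [0, t], so on each of the n cells the
    error is at most a constant times the squared length of the cell. *)
Lemma Riemann_sum_C1 g t : 0 <= t -> C1 g ->
  exists L, forall n, (0 < n)%N ->
    \sum_(i < n) t / n%:R * g (grid t n i) <=
      \int[mu]_(s in `[0, t]) g s + L / n%:R.
Proof.
move=> t0 C1g; have [L L0 HL] := C1_lipschitz t0 C1g; have cg := C1_cont C1g.
exists (L * t * t) => n n0.
have nR : n%:R != 0 :> R by rewrite pnatr_eq0 -lt0n.
rewrite (Rintegral_grid t0 n0); last exact: continuous_integrable.
have -> : L * t * t / n%:R = \sum_(i < n) L * (t / n%:R) * (t / n%:R) :> R.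
  by rewrite sumr_const card_ord -mulr_natr; field.
rewrite -big_split/=; apply: ler_sum => i _.
have gi := grid_ge0 n i t0.
have gle : grid t n i.+1 <= t by exact: grid_le.
have gS := le_grid n t0 (leqnSn i).
have E (c : R) : \int[mu]_(s in `[grid t n i, grid t n i.+1]) c = t / n%:R * c.
  rewrite Rintegral_cst//= lebesgue_measure_itv/= lte_fin.
  case: ltP => h; first by rewrite -EFinB/= gridS mulrC.
  by rewrite -(gridS t n i) mulr0 (le_anti (introT andP (conj h gS))) subrr mul0r.
rewrite -lerBlDr.
have -> : t / n%:R * g (grid t n i) - L * (t / n%:R) * (t / n%:R) =
  t / n%:R * (g (grid t n i) - L * (t / n%:R)) by ring.
rewrite -E; apply: le_Rintegral => //.
- by apply: continuous_integrable => x; exact: cvg_cst.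
- exact: continuous_integrable.
move=> s /=; rewrite in_itv/= => /andP[s1 s2].
rewrite lerBlDr -lerBlDl; apply: le_trans (ler_norm _) _.
apply: le_trans (HL _ _ _ _) _.
- by rewrite gi (le_trans gS).
- by rewrite (le_trans gi) //= (le_trans s2).
rewrite ler_wpM2l// -(gridS t n i) ler0_norm ?subr_le0// opprB lerD2r//.
Qed.

End intervals.

(** * Applications of Fubini's theorem *)

Section product.
Context {R : realType} d1 d2 (T1 : measurableType d1) (T2 : measurableType d2).
Variables (m1 : {sigma_finite_measure set T1 -> \bar R})
  (m2 : {sigma_finite_measure set T2 -> \bar R}).

Lemma integrable_tensor (f : T1 -> R) (g : T2 -> R) :
  m1.-integrable setT (EFin \o f) -> m2.-integrable setT (EFin \o g) ->
  (m1 \x m2)%E.-integrable setT (EFin \o (fun z => f z.1 * g z.2)).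
Proof.
move=> intf intg.
have mf : measurable_fun setT f by apply/measurable_EFinP; exact: measurable_int intf.
have mg : measurable_fun setT g by apply/measurable_EFinP; exact: measurable_int intg.
have [_ gfin] := integrableP _ _ _ intg.
have [_ ffin] := integrableP _ _ _ intf.
apply/integrable12ltyP.
  apply/measurable_EFinP; apply: measurable_funM.
  - by apply: measurableT_comp => //; exact: measurable_fst.
  - by apply: measurableT_comp => //; exact: measurable_snd.
rewrite (eq_integral (fun x => `|f x|%:E * \int[m2]_y `|(EFin \o g) y|)%E).
  rewrite ge0_integralZr//.
  - by rewrite lte_mul_pinfty//; [exact: integral_ge0|rewrite ge0_fin_numE//; exact: integral_ge0].
  - by apply/measurable_EFinP; exact: measurableT_comp.
  - exact: integral_ge0.
move=> x _; rewrite -ge0_integralZl_EFin//.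
- by apply: eq_integral => y _; rewrite /= normrM EFinM.
- by do 2 apply: measurableT_comp => //.
Qed.

End product.

Section triangle.
Context {R : realType}.
Implicit Types f g : R -> R.
Notation mu := (@lebesgue_measure R).

(** Integration by parts when one factor is only the primitive of an integrable
    function: exchange the order of integration of phi' s * f r over the
    triangle 0 <= r <= s <= t. *)
Lemma triangle_Fubini (phi phi' f : R -> R) (t : R) : 0 <= t ->
  continuous phi' -> (forall s, is_derive s (1 : R) phi (phi' s)) ->
  mu.-integrable `[0, t] (EFin \o f) ->
  let D s := \int[mu]_(r in `[0, s]) f r in
  mu.-integrable `[0, t] (EFin \o (fun s => phi' s * D s)) /\
  phi t * D t = \int[mu]_(s in `[0, t]) (phi s * f s) +
                \int[mu]_(s in `[0, t]) (phi' s * D s).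
Proof.
move=> t0 cphi' dphi intf D; have cphi := is_derive_cont dphi.
pose f0 := f \_ `[0, t]; pose p0 := phi' \_ `[0, t].
have if0 : mu.-integrable setT (EFin \o f0).
  rewrite /f0 -restrict_EFin.
  have H := (@integrable_mkcond _ _ _ mu `[0, t] (EFin \o f) (measurable_itv _)).1 intf.
  exact: H.
have ip0 : mu.-integrable setT (EFin \o p0).
  rewrite /p0 -restrict_EFin.
  apply: (@integrable_mkcond _ _ _ mu `[0, t] (EFin \o phi') (measurable_itv _)).1.
  exact: continuous_integrable.
(* The integrand on the triangle, extended by 0 to the plane. *)
pose F (z : R * R) : \bar R := (if z.2 <= z.1 then p0 z.1 * f0 z.2 else 0)%:E.
have intF : (mu \x mu)%E.-integrable setT F.
  have G := integrable_tensor ip0 if0.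
  have mG := measurable_int _ G.
  apply: (le_integrable measurableT _ _ G).
    apply/measurable_EFinP; apply: measurable_fun_ifT => //.
    - by apply: measurable_fun_ler; [exact: measurable_snd|exact: measurable_fst].
    - exact/measurable_EFinP.
  move=> [s r] _; rewrite /F/=; case: ifP => // _.
  by rewrite normr0 lee_fin.
have F1 s : (\int[mu]_r F (s, r) = ((fun s => phi' s * D s) \_ `[0, t] s)%:E)%E.
  rewrite patchE; case: ifPn => [|sn]; last first.
    by rewrite /F /p0/= patchE (negbTE sn); under eq_integral do rewrite mul0r if_same;
      rewrite integral0.
  rewrite inE/= in_itv/= => /andP[s0 st].
  have intfs : mu.-integrable `[0, s] (EFin \o f) by apply: integrable_sub_itv intf.
  rewrite EFinM /D /Rintegral fineK; last exact: integrable_fin_num.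
  rewrite -integralZl// integral_mkcond; apply: eq_integral => r _.
  rewrite /F/= /p0 /f0 !patchE !mem_setE !in_itv/= s0 st/=.
  have [rs|sr] := leP r s; last by rewrite andbF.
  by rewrite (le_trans rs st) !andbT; case: ifP => //; rewrite mulr0.
have F2 r : (\int[mu]_s F (s, r) =
    ((fun r => f r * (phi t - phi r)) \_ `[0%R, t] r)%:E)%E.
  rewrite patchE; case: ifPn => [|rn]; last first.
    rewrite (eq_integral (cst 0%E)) ?integral0// => s _.
    by rewrite /F /f0/= patchE (negbTE rn) mulr0 if_same.
  rewrite mem_setE in_itv/= => /andP[r0 rt].
  rewrite -(Rintegral_FTC rt cphi' dphi) EFinM /Rintegral.
  rewrite fineK; last exact/integrable_fin_num/continuous_integrable.
  rewrite -integralZl//; last exact: continuous_integrable.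
  rewrite [RHS]integral_mkcond; apply: eq_integral => s _.
  rewrite /F/= /p0 /f0 !patchE !mem_setE !in_itv/= r0 rt/=.
  have [rs|sr] := leP r s => //.
  by rewrite (le_trans r0 rs)/=; case: ifP => //; rewrite mulrC// mulr0.
have E := Fubini intF.
have iF : mu.-integrable `[0, t] (EFin \o (fun s => phi' s * D s)).
  apply: (@integrable_mkcond _ _ _ mu `[0, t] _ (measurable_itv _)).2.
  apply: eq_integrable (integrable_fubini_F intF) => // s _.
  by rewrite /fubini_F F1 restrict_EFin.
split=> //.
have ipf : mu.-integrable `[0, t] (EFin \o (fun s => phi s * f s)).
  exact: continuous_mul_integrable.
apply/eqP; rewrite -subr_eq eq_sym; apply/eqP.
have : (\int[mu]_(s in `[0, t]) (phi' s * D s) =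
        \int[mu]_(r in `[0, t]) (f r * (phi t - phi r)))%R.
  rewrite Rintegral_mkcond [RHS]Rintegral_mkcond /Rintegral.
  congr fine; transitivity (\int[mu]_s \int[mu]_r F (s, r))%E.
    by apply/esym/eq_integral => s _; exact: F1.
  by rewrite E; apply: eq_integral => r _; exact: F2.
move=> ->.
have iptf : mu.-integrable `[0, t] (EFin \o (fun s => phi t * f s)).
  by apply: continuous_mul_integrable => // x; exact: cvg_cst.
rewrite (_ : \int[mu]_(r in `[0, t]) (f r * (phi t - phi r)) =
  \int[mu]_(r in `[0, t]) (phi t * f r - phi r * f r)).
  by rewrite RintegralB// RintegralZl// opprB addrC subrK.
by apply: eq_Rintegral => s _; ring.
Qed.

End triangle.

Section parametric.
Context {R : realType} d (T : measurableType d).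
Notation mu := (@lebesgue_measure R).

(** Tonelli's theorem applied to the positive and to the negative part. *)
Lemma measurable_param_Rintegral (d' : measure_display) (T' : measurableType d')
   (m : {sigma_finite_measure set T' -> \bar R}) (g : T * T' -> R) :
  measurable_fun setT g ->
  measurable_fun setT (fun x => \int[m]_y g (x, y)).
Proof.
move=> mg; have mG : measurable_fun setT (EFin \o g) by exact/measurable_EFinP.
apply: measurableT_comp; first exact: fine_measurable.
rewrite [X in measurable_fun _ X](_ : _ = fun x =>
   (\int[m]_y (EFin \o g)^\+ (x, y) - \int[m]_y (EFin \o g)^\- (x, y))%E).
  apply: emeasurable_funB.
  - apply: (measurable_fun_fubini_tonelli_F (m2 := m) (EFin \o g)^\+)%E => //.
    exact: measurable_funepos.
  - apply: (measurable_fun_fubini_tonelli_F (m2 := m) (EFin \o g)^\-)%E => //.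
    exact: measurable_funeneg.
apply/funext => x; rewrite integralE.
by congr (_ - _)%E; apply: eq_integral => y _; rewrite ?funeposE ?funenegE.
Qed.

End parametric.

(** * Square integrable random variables *)

Section L2.
Context {R : realType} d (T : measurableType d) (P : probability T R).
Implicit Types X Y : T -> R.

Definition L2 X := measurable_fun setT X /\
  P.-integrable setT (EFin \o (fun w => X w ^+ 2)).

Lemma L2_mul_integrable X Y : L2 X -> L2 Y ->
  P.-integrable setT (EFin \o (fun w => X w * Y w)).
Proof.
move=> [mX iX] [mY iY].
apply: (le_integrable measurableT _ _ (integrableD measurableT iX iY)).
  by apply/measurable_EFinP; exact: measurable_funM.
move=> w _; rewrite /= lee_fin normrM [leRHS]ger0_norm ?addr_ge0 ?sqr_ge0//.
rewrite -(real_normK (num_real (X w))) -(real_normK (num_real (Y w))).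
have := sqr_ge0 (`|X w| - `|Y w|).
have := mulr_ge0 (normr_ge0 (X w)) (normr_ge0 (Y w)).
by rewrite sqrrB; lra.
Qed.

Lemma L2_cst (a : R) : L2 (fun=> a).
Proof.
by split; [exact: measurable_cst|exact: finite_measure_integrable_cst].
Qed.

Lemma L2_integrable X : L2 X -> P.-integrable setT (EFin \o X).
Proof.
move=> LX; have := L2_mul_integrable LX (L2_cst 1).
by apply: eq_integrable => // w _; rewrite /= mulr1.
Qed.

Lemma L2D X Y : L2 X -> L2 Y -> L2 (fun w => X w + Y w).
Proof.
move=> LX LY; have iXY := L2_mul_integrable LX LY.
case: LX LY => mX iX [mY iY]; split; first exact: measurable_funD.
have := integrableD measurableT (integrableD measurableT iX iY)
   (integrableZl measurableT 2 iXY).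
by apply: eq_integrable => // w _ /=; congr EFin; ring.
Qed.

Lemma L2Z (a : R) X : L2 X -> L2 (fun w => a * X w).
Proof.
move=> [mX iX]; split; first exact: measurable_funM.
have := integrableZl measurableT (a ^+ 2) iX.
by apply: eq_integrable => // w _ /=; rewrite exprMn.
Qed.

Lemma L2B X Y : L2 X -> L2 Y -> L2 (fun w => X w - Y w).
Proof.
move=> LX LY; have := L2D LX (L2Z (-1) LY).
by congr L2; apply/funext => w; rewrite mulN1r.
Qed.

Lemma L2_sum I (r : seq I) (X : I -> T -> R) :
  (forall i, L2 (X i)) -> L2 (fun w => \sum_(i <- r) X i w).
Proof.
move=> LX; elim: r => [|i r IH].
  by under eq_fun do rewrite big_nil; exact: L2_cst.
by under eq_fun do rewrite big_cons; exact: L2D.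
Qed.

Lemma Rintegral_sum I (r : seq I) (X : I -> T -> R) :
  (forall i, P.-integrable setT (EFin \o X i)) ->
  \int[P]_w (\sum_(i <- r) X i w) = \sum_(i <- r) \int[P]_w X i w.
Proof.
move=> iX; elim: r => [|i r IH].
  under eq_Rintegral do rewrite big_nil.
  by rewrite Rintegral_cst// mul0r big_nil.
under eq_Rintegral do rewrite big_cons.
rewrite big_cons RintegralD// ?IH//.
have := @integrable_sum _ _ _ P _ measurableT _ r xpredT _ (fun i _ => iX i).
by apply: eq_integrable => // w _; rewrite /= sumEFin.
Qed.

Lemma Rintegral_sqr_sum (I : finType) (X : I -> T -> R) :
  (forall i, L2 (X i)) ->
  \int[P]_w (\sum_i X i w) ^+ 2 = \sum_i \sum_j \int[P]_w (X i w * X j w).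
Proof.
move=> LX.
under eq_Rintegral do rewrite expr2 mulr_suml.
rewrite Rintegral_sum; last first.
  by move=> i; apply: L2_mul_integrable => //; exact: L2_sum.
apply: eq_bigr => i _; under eq_Rintegral do rewrite mulr_sumr.
by rewrite Rintegral_sum// => j; exact: L2_mul_integrable.
Qed.

Lemma Rintegral_norm_le_sqrt X : L2 X ->
  \int[P]_w `|X w| <= Num.sqrt (\int[P]_w X w ^+ 2).
Proof.
move=> LX; have iX := integrable_norm (L2_integrable LX); case: (LX) => mX iX2.
rewrite -[leRHS]mulr1 -[X in _ * X]sqrtr1.
apply: le_sqrt_of_amgm => //.
  by apply: Rintegral_ge0 => w _; exact: sqr_ge0.
move=> l l0.
have i1 := finite_measure_integrable_cst P l^-1 measurableT.
have ilX := integrableZl measurableT l iX2.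
have -> : l^-1 * 1 = \int[P]_w l^-1.
  by rewrite Rintegral_cst// [X in fine X](probability_setT P).
rewrite -RintegralZl// -RintegralZl// -RintegralD//.
apply: le_Rintegral => //.
- exact: (integrableZl measurableT 2 iX).
- exact: (integrableD measurableT ilX i1).
move=> w _; rewrite -(real_normK (num_real (X w))) -subr_ge0.
have -> : l * `|X w| ^+ 2 + l^-1 - 2 * `|X w| = l^-1 * (l * `|X w| - 1) ^+ 2.
  by field; rewrite gt_eqF.
by rewrite mulr_ge0 ?sqr_ge0// invr_ge0 ltW.
Qed.

End L2.

(** * Independence and measurability of coordinates *)

Section independence.
Context {R : realType} d (T : measurableType d) (P : probability T R).

(** The product rule on rectangles identifies the law of (X, Y) with the product
    of the two laws; Fubini's theorem then factors the expectation. *)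
Lemma expectation_mul_indep (X Y : T -> R) : L2 P X -> L2 P Y ->
  (forall A B : set R, measurable A -> measurable B ->
    P (X @^-1` A `&` Y @^-1` B) = (P (X @^-1` A) * P (Y @^-1` B))%E) ->
  \int[P]_w (X w * Y w) = \int[P]_w X w * \int[P]_w Y w.
Proof.
move=> LX LY ind.
have [mX _] := LX; have [mY _] := LY.
have iX := L2_integrable LX; have iY := L2_integrable LY.
have iXY := L2_mul_integrable LX LY.
pose X' : {mfun T >-> R} := HB.pack X (isMeasurableFun.Build _ _ _ _ X mX).
pose Y' : {mfun T >-> R} := HB.pack Y (isMeasurableFun.Build _ _ _ _ Y mY).
have mZ : measurable_fun setT (fun w => (X w, Y w)) by exact: measurable_fun_pair.
pose Z' : {mfun T >-> (R * R)%type} :=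
  HB.pack (fun w => (X w, Y w)) (isMeasurableFun.Build _ _ _ _ _ mZ).
pose mu1 := distribution P X'; pose mu2 := distribution P Y'.
pose f (z : R * R) := (z.1 * z.2)%:E.
have mf : measurable_fun setT f.
  apply/measurable_EFinP; apply: measurable_funM.
  - exact: measurable_fst.
  - exact: measurable_snd.
have law (A : set (R * R)) : measurable A -> (mu1 \x mu2)%E A = distribution P Z' A.
  by apply: product_measure_unique => B C mB mC; exact: ind.
have eZ : (\int[distribution P Z']_z f z = \int[P]_w (X w * Y w)%:E)%E.
  exact: (@integral_distribution _ _ _ _ _ P Z').
have e1 : (\int[(mu1 \x mu2)%E]_z f z = \int[distribution P Z']_z f z)%E.
  by apply: eq_measure_integral => A mA _; exact: law.
have mid : measurable_fun [set: R] (@EFin R) by exact/measurable_EFinP.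
have imu1 : mu1.-integrable setT (@EFin R).
  exact: (@integrable_pushforward _ _ _ _ _ _ mX _ _ _ mid iX measurableT).
have imu2 : mu2.-integrable setT (@EFin R).
  exact: (@integrable_pushforward _ _ _ _ _ _ mY _ _ _ mid iY measurableT).
have if' : (mu1 \x mu2)%E.-integrable setT f.
  exact: (@integrable_tensor R _ _ _ _ mu1 mu2 id id imu1 imu2).
have := integral12_prod_meas1 if'; rewrite e1 eZ => E.
rewrite /Rintegral -E.
have EX : (\int[mu1]_x x%:E = \int[P]_w (X w)%:E)%E.
  exact: (@integral_distribution _ _ _ _ _ P X').
have EY : (\int[mu2]_x x%:E = \int[P]_w (Y w)%:E)%E.
  exact: (@integral_distribution _ _ _ _ _ P Y').
have fX : (\int[mu1]_x x%:E \is a fin_num)%E by exact: integrable_fin_num imu1.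
have fY : (\int[mu2]_x x%:E \is a fin_num)%E by exact: integrable_fin_num imu2.
rewrite -EX -EY -fineM//; congr fine.
rewrite -(fineK fY) -integralZr//; apply: eq_integral => x _.
by rewrite fineK// -integralZl.
Qed.

End independence.

Section coordinates.
Context {R : realType}.

(** The real sets whose preimage under the coordinate is Borel form a sigma-algebra,
    and it contains the open intervals because the coordinate is continuous. *)
Lemma borel_coord m (j : 'I_m) (B : set R) : measurable B ->
  borel_sets [set v : 'cV[R]_m | B (v j 0)].
Proof.
move=> mB.
have sig : sigma_algebra setT (image_set_system setT (fun v : 'cV[R]_m => v j 0)
    (@borel_sets R m)).
  by apply: sigma_algebra_image; exact: smallest_sigma_algebra.
suff : image_set_system setT (fun v : 'cV[R]_m => v j 0) (@borel_sets R m) B.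
  by rewrite /image_set_system/= setTI.
have : (@RGenOpens.G R).-sigma.-measurable B by rewrite -RGenOpens.measurableE.
apply: smallest_sub => //.
move=> _ [x [y ->]]; rewrite /image_set_system/= setTI.
apply: sub_sigma_algebra.
apply: (open_comp (f := fun v : 'cV[R]_m => v j 0)); last exact: interval_open.
by move=> v _; exact: coord_continuous.
Qed.

Context d (Omega : measurableType d) (P : probability Omega R)
  (F : R -> set_system Omega).

Lemma adapted_coord m (X : R -> Omega -> 'cV[R]_m) (t : R) (j : 'I_m) B :
  adapted F X -> 0 <= t -> measurable B ->
  F t ((fun w => X t w j 0) @^-1` B).
Proof. by move=> aX t0 mB; exact: (aX t t0 _ (borel_coord j mB)). Qed.

Lemma adapted_measurable m (X : R -> Omega -> 'cV[R]_m) (t : R) (j : 'I_m) :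
  usual_filtration P F -> adapted F X -> 0 <= t ->
  measurable_fun setT (fun w => X t w j 0).
Proof.
move=> [H _ _ _] aX t0 _ B mB; rewrite setTI.
by apply: (H t t0).2; exact: adapted_coord.
Qed.

(** The extension by 0 to negative times is measurable on the whole product
    space, so that Tonelli's theorem applies to it. *)
Lemma jointly_measurable_coord m (X : R -> Omega -> 'cV[R]_m) (j : 'I_m) :
  jointly_measurable X ->
  measurable_fun setT (fun z : measurableTypeR R * Omega =>
    if 0 <= z.1 then X z.1 z.2 j 0 else 0).
Proof.
move=> jX _ B mB; rewrite setTI.
have m0 : measurable [set z : measurableTypeR R * Omega | 0 <= z.1].
  rewrite (_ : [set _ | _] = `[0, +oo[%classic `*` setT).
    by apply: measurableX => //; exact: measurable_itv.
  by apply/seteqP; split => z /=; rewrite in_itv/= andbT; [split|case].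
rewrite (_ : _ @^-1` _ = [set z | 0 <= z.1 /\ B (X z.1 z.2 j 0)] `|`
   (if 0 \in B then ~` [set z | 0 <= z.1] else set0)).
  apply: measurableU; first exact: (jX _ (borel_coord j mB)).
  by case: ifP => // _; exact: measurableC.
apply/seteqP; split => z /=.
  case: ifPn => z0 Bz; first by left.
  by right; rewrite mem_set//=; exact/negP.
move=> [[-> //]|]; case: ifPn => // /set_mem B0 /negP/negbTE /= ->//.
Qed.

End coordinates.

(** * Second moments of the noise *)

Section moments.
Context {R : realType} d (Omega : measurableType d) (P : probability Omega R).
Variables (F : R -> set_system Omega) (m : nat) (M : R -> Omega -> 'cV[R]_m)
  (K : 'M[R]_m).
Hypotheses (hF : usual_filtration P F) (hL : levy_process P F M)
  (h2 : square_integrable P M) (h0 : mean_zero P M)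
  (hK : covariance_matrix P M K).

Let aM : adapted F M. Proof. by have [] := hL. Qed.

Lemma levy_L2 t j : 0 <= t -> L2 P (fun w => M t w j 0).
Proof.
move=> t0; have mM k : measurable_fun setT (fun w => M t w k 0).
  exact: adapted_measurable hF aM t0.
split; first exact: mM.
apply/integrableP; split.
  by apply/measurable_EFinP; exact: measurable_funX.
apply: le_lt_trans (h2 t0); apply: ge0_le_integral => //.
- by apply: measurableT_comp => //; apply/measurable_EFinP; exact: measurable_funX.
- apply/measurable_EFinP; under eq_fun do rewrite sqr_frob_col.
  by apply: measurable_sum => k; exact: measurable_funX.
- move=> w _; rewrite /= lee_fin ger0_norm ?sqr_ge0// sqr_frob_col.
  by rewrite (bigD1 j)//= lerDl sumr_ge0// => k _; exact: sqr_ge0.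
Qed.

Let mean0 t j : 0 <= t -> \int[P]_w M t w j 0 = 0.
Proof. by move=> t0; have := h0 j t0; rewrite unlock /Rintegral => ->. Qed.

Let cov0 t i j : 0 <= t -> \int[P]_w (M t w i 0 * M t w j 0) = K i j * t.
Proof.
move=> t0; have := hK i j t0; rewrite unlock /Rintegral => H.
rewrite -[RHS]/(fine (K i j * t)%:E) -H; congr fine; apply: eq_integral => w _.
by rewrite mxE big_ord1 mxE.
Qed.

(** M s is F t-measurable for s <= t, hence independent of the later increment,
    which has mean zero. *)
Let incr_orth s t h i j : 0 <= s -> s <= t -> 0 <= h ->
  \int[P]_w (M s w i 0 * (M (t + h) w j 0 - M t w j 0)) = 0.
Proof.
move=> s0 st h_ge0; have t0 := le_trans s0 st; have th0 := addr_ge0 t0 h_ge0.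
rewrite expectation_mul_indep; [|exact: levy_L2|by apply: L2B; exact: levy_L2|].
  by rewrite mean0// mul0r.
move=> A B mA mB; have [_ _ ind _ _] := hL.
have [_ mono _ _] := hF.
have := ind t h t0 h_ge0 _ _ (mono _ _ s0 st _ (adapted_coord i aM s0 mA))
  (borel_coord j mB).
rewrite /incr (_ : (fun w => M (t + h) w - M t w) @^-1` [set v | B (v j 0)] =
  (fun w => M (t + h) w j 0 - M t w j 0) @^-1` B).
  exact.
by apply/seteqP; split => w /=; rewrite !mxE.
Qed.

Let KC i j : K i j = K j i.
Proof.
rewrite -[LHS]mulr1 -[RHS]mulr1 -!cov0//.
by apply: eq_Rintegral => w _; rewrite mulrC.
Qed.

(** For s <= t write M t = M s + (M t - M s) and use the orthogonality of the
    second term to M s. *)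
Lemma levy_cov s t i j : 0 <= s -> 0 <= t ->
  \int[P]_w (M s w i 0 * M t w j 0) = K i j * Num.min s t.
Proof.
wlog st : s t i j / s <= t => [H|s0 t0].
  move=> s0 t0; case/orP: (le_total s t) => [st|ts]; first exact: H.
  under eq_Rintegral do rewrite mulrC.
  by rewrite H// KC minC.
have ts0 : 0 <= t - s by rewrite subr_ge0.
have := incr_orth i j s0 (lexx s) ts0.
rewrite subrKC => E; rewrite min_l// -cov0// -[LHS]subr0 -E -RintegralB//.
- by apply: eq_Rintegral => w _; ring.
- by apply: L2_mul_integrable; exact: levy_L2.
- by apply: L2_mul_integrable; [|apply: L2B]; exact: levy_L2.
Qed.

Lemma levy_incr_L2 a b j : 0 <= a -> 0 <= b ->
  L2 P (fun w => M b w j 0 - M a w j 0).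
Proof. by move=> a0 b0; apply: L2B; exact: levy_L2. Qed.

Lemma levy_incr_cov a b a' b' i j : 0 <= a -> 0 <= b -> 0 <= a' -> 0 <= b' ->
  \int[P]_w ((M b w i 0 - M a w i 0) * (M b' w j 0 - M a' w j 0)) =
  K i j * (Num.min b b' - Num.min b a' - Num.min a b' + Num.min a a').
Proof.
move=> a0 b0 a'0 b'0.
have i2 s t : 0 <= s -> 0 <= t ->
    P.-integrable setT (EFin \o (fun w => M s w i 0 * M t w j 0)).
  by move=> s0 t0; apply: L2_mul_integrable; exact: levy_L2.
have i3 s t t' : 0 <= s -> 0 <= t -> 0 <= t' ->
    P.-integrable setT (EFin \o (fun w => M s w i 0 * M t w j 0 - M s w i 0 * M t' w j 0)).
  by move=> s0 t0 t'0; apply: (integrableB measurableT (i2 s t s0 t0) (i2 s t' s0 t'0)).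
transitivity (\int[P]_w ((M b w i 0 * M b' w j 0 - M b w i 0 * M a' w j 0) -
  (M a w i 0 * M b' w j 0 - M a w i 0 * M a' w j 0))).
  by apply: eq_Rintegral => w _; ring.
rewrite RintegralB//; [|exact: i3|exact: i3].
rewrite !RintegralB//; try exact: i2.
by rewrite !levy_cov//; ring.
Qed.

Lemma levy_incr_abs a b j : 0 <= a -> a <= b ->
  \int[P]_w `|M b w j 0 - M a w j 0| <= Num.sqrt (K j j * (b - a)).
Proof.
move=> a0 ab; have b0 := le_trans a0 ab.
apply: le_trans (Rintegral_norm_le_sqrt (levy_incr_L2 j a0 b0)) _.
under eq_Rintegral do rewrite expr2.
rewrite levy_incr_cov// !minxx (min_r ab) (min_l ab).
by rewrite [X in _ * X](_ : _ = b - a)//; ring.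
Qed.

(** The isometry of the stochastic integral for step functions: increments over
    different cells are uncorrelated. *)
Lemma levy_sum_sqr t n (c : 'I_n -> 'I_m -> R) : 0 <= t ->
  \int[P]_w (\sum_i \sum_l
     c i l * (M (grid t n i.+1) w l 0 - M (grid t n i) w l 0)) ^+ 2 =
  \sum_i t / n%:R * \sum_l \sum_k c i l * K l k * c i k.
Proof.
move=> t0; have g0 i : 0 <= grid t n i by exact: grid_ge0.
pose X (q : 'I_n * 'I_m) w : R :=
  c q.1 q.2 * (M (grid t n q.1.+1) w q.2 0 - M (grid t n q.1) w q.2 0).
under eq_Rintegral do rewrite pair_big/=.
rewrite (@Rintegral_sqr_sum _ _ _ P _ X); last first.
  by move=> q; apply: L2Z; exact: levy_incr_L2.
have E q q' : \int[P]_w (X q w * X q' w) =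
    if q.1 == q'.1 then t / n%:R * (c q.1 q.2 * K q.2 q'.2 * c q.1 q'.2) else 0.
  rewrite /X; under eq_Rintegral do rewrite mulrACA.
  rewrite RintegralZl//; last by apply: L2_mul_integrable; exact: levy_incr_L2.
  rewrite levy_incr_cov//.
  have [<-|qq'] := eqVneq q.1 q'.1.
    rewrite !minxx (min_r (le_grid n t0 (leqnSn _))) (min_l (le_grid n t0 (leqnSn _))).
    by rewrite -(gridS t n q.1); ring.
  (* Over disjoint cells the four minima cancel. *)
  rewrite [X in _ * (_ * X)](_ : _ = 0) ?mulr0//.
  have [lt|lt|/val_inj e] := ltngtP q.1 q'.1; last by rewrite e eqxx in qq'.
  - have h1 := le_grid n t0 lt.
    have h2' := le_trans h1 (le_grid n t0 (leqnSn _)).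
    have h3 := le_grid n t0 (ltnW lt).
    have h4 := le_trans h3 (le_grid n t0 (leqnSn _)).
    by rewrite !min_l//; ring.
  - have h1 := le_grid n t0 lt.
    have h2' := le_trans h1 (le_grid n t0 (leqnSn _)).
    have h3 := le_grid n t0 (ltnW lt).
    have h4 := le_trans h3 (le_grid n t0 (leqnSn _)).
    by rewrite !min_r//; ring.
rewrite -(pair_bigA _ (fun i l => \sum_q' \int[P]_w (X (i, l) w * X q' w)))/=.
apply: eq_bigr => i _; rewrite mulr_sumr; apply: eq_bigr => l _.
rewrite -(pair_bigA _ (fun i' k => \int[P]_w (X (i, l) w * X (i', k) w)))/=.
rewrite (bigD1 i)//= [X in _ + X]big1 ?addr0; last first.
  by move=> i' ni; rewrite big1// => k _; rewrite E/= eq_sym (negbTE ni).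
by rewrite mulr_sumr; apply: eq_bigr => k _; rewrite E/= eqxx.
Qed.

End moments.

(** * Variation of constants along a path *)

Section backward.
Context {R : realType} {n : nat}.
Notation mu := (@lebesgue_measure R).

(** The solution of phi' = - phi A with phi t = c.  Pairing the state with it
    removes the term A x from the equation. *)
Definition backward (c : 'rV[R]_n) (A : 'M[R]_n) (t s : R) : 'rV[R]_n :=
  c *m expmx ((t - s) *: A).

(** The derivative of [backward] in s. *)
Definition backward' (c : 'rV[R]_n) (A : 'M[R]_n) (t s : R) : 'rV[R]_n :=
  - (backward c A t s *m A).

Implicit Types (c : 'rV[R]_n) (A : 'M[R]_n).

Lemma backward_end c A t : backward c A t t = c.
Proof. by rewrite /backward subrr expmx0 mulmx1. Qed.

Lemma backward_C1 c A t i j : C1 (fun s => backward c A t s i j).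
Proof.
apply: mulmx_entry_C1 => [k l|k l]; first exact: C1_cst.
by apply: (@C1_refl _ t (fun s => expmx (s *: A) k l)); exact: expmx_C1.
Qed.

Lemma backward'_cont c A t j : continuous (fun s => backward' c A t s 0 j).
Proof.
apply: C1_cont; rewrite /backward'; under eq_fun do rewrite mxE; apply: C1N.
by apply: mulmx_entry_C1 => [k l|k l]; [exact: backward_C1|exact: C1_cst].
Qed.

Lemma is_derive_backward c A t j s :
  is_derive s (1 : R) (fun s => backward c A t s 0 j) (backward' c A t s 0 j).
Proof.
have E k : is_derive s (1 : R) (fun s => expmx ((t - s) *: A) k j)
    (- (expmx ((t - s) *: A) *m A) k j).
  have h : is_derive s (1 : R) (fun s : R => t - s) (-1).
    by apply: is_derive_eq; rewrite add0r mul1r.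
  have := @is_derive1_comp _ (fun s => expmx (s *: A) k j) (fun s : R => t - s)
    s _ _ (is_derive_expmx A _ k j) h.
  by rewrite mulrN1.
rewrite [X in is_derive _ _ X](_ : _ =
    \sum_k (fun s => c 0 k * expmx ((t - s) *: A) k j)); last first.
  by apply/funext => r; rewrite mxE fct_sumE.
rewrite (_ : backward' c A t s 0 j =
    \sum_k (c 0 k * - (expmx ((t - s) *: A) *m A) k j)).
  by apply: is_derive_sum => k; exact: is_deriveZ.
rewrite /backward' /backward -mulmxA mxE mxE -sumrN.
by apply: eq_bigr => k _; rewrite mulrN.
Qed.

(** One path of the system: x and u are the coordinates of the state and of the
    control as functions of time, D is the integrated drift, and N = x - D is
    the contribution of the noise. *)
Section path.
Context {m1 : nat} (c : 'rV[R]_n) (A : 'M[R]_n) (B1 : 'M[R]_(n, m1)) (t : R).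
Variables (x : 'I_n -> R -> R) (u : 'I_m1 -> R -> R).
Let f j s := \sum_l A j l * x l s + \sum_k B1 j k * u k s.
Let D j s := \int[mu]_(r in `[0, s]) f j r.
Let N j s := x j s - D j s.
Hypotheses (t0 : 0 <= t)
  (intf : forall j, mu.-integrable `[0, t] (EFin \o f j))
  (intu : forall k, mu.-integrable `[0, t] (EFin \o u k))
  (intN : forall j, mu.-integrable `[0, t] (EFin \o N j)).
Let phi s := backward c A t s.
Let phi' s := backward' c A t s.

Let int_sum I (r : seq I) (h : I -> R -> R) :
  (forall i, mu.-integrable `[0, t] (EFin \o h i)) ->
  mu.-integrable `[0, t] (EFin \o (fun s => \sum_(i <- r) h i s)).
Proof.
move=> H.
have := @integrable_sum _ _ _ mu _ (measurable_itv `[0, t]) _ r xpredT _ (fun i _ => H i).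
by apply: eq_integrable => // s _; rewrite /= sumEFin.
Qed.

Let Rint_sum I (r : seq I) (h : I -> R -> R) :
  (forall i, mu.-integrable `[0, t] (EFin \o h i)) ->
  \int[mu]_(s in `[0, t]) (\sum_(i <- r) h i s) =
  \sum_(i <- r) \int[mu]_(s in `[0, t]) h i s.
Proof.
move=> H; elim: r => [|i r IH].
  under eq_Rintegral do rewrite big_nil.
  by rewrite Rintegral_cst// mul0r big_nil.
under eq_Rintegral do rewrite big_cons.
by rewrite big_cons RintegralD// ?IH//; exact: int_sum.
Qed.

(** D is the primitive of f = A x + B1 u = A D + A N + B1 u.  Integrating phi f by
    parts turns the terms phi A D into the ones that cancel them, and leaves
    phi B1 u and phi A N = - phi' N. *)
Lemma variation_of_constants :
  \sum_j phi t 0 j * D j t =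
  \int[mu]_(s in `[0, t]) (\sum_k (phi s *m B1) 0 k * u k s) -
  \sum_j \int[mu]_(s in `[0, t]) (phi' s 0 j * N j s).
Proof.
have T j := triangle_Fubini t0 (backward'_cont (c := c) (A := A) (t := t) (j := j))
  (is_derive_backward c A t j) (intf j).
have iphif j : mu.-integrable `[0, t] (EFin \o (fun s => phi s 0 j * f j s)).
  by apply: continuous_mul_integrable => //; exact/C1_cont/backward_C1.
have iphiD j : mu.-integrable `[0, t] (EFin \o (fun s => phi' s 0 j * D j s)).
  exact: (T j).1.
have iphiN j : mu.-integrable `[0, t] (EFin \o (fun s => phi' s 0 j * N j s)).
  by apply: continuous_mul_integrable => //; exact: backward'_cont.
transitivity (\int[mu]_(s in `[0, t])
   (\sum_j phi s 0 j * f j s + \sum_j phi' s 0 j * D j s)).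
  rewrite RintegralD//; [|exact: int_sum|exact: int_sum].
  by rewrite !Rint_sum// -big_split/=; apply: eq_bigr => j _; exact: (T j).2.
have iB : mu.-integrable `[0, t]
    (EFin \o (fun s => \sum_k (phi s *m B1) 0 k * u k s)).
  apply: int_sum => k; apply: continuous_mul_integrable => //.
  apply/C1_cont/mulmx_entry_C1 => [i j|i j]; first exact: backward_C1.
  exact: C1_cst.
rewrite -Rint_sum// -RintegralB//; last exact: int_sum.
apply: eq_Rintegral => s _.
have E j : phi' s 0 j = - \sum_i phi s 0 i * A i j.
  by rewrite /phi' /backward' mxE mxE.
under [X in _ + X = _]eq_bigr do rewrite E.
under [X in _ = _ - X]eq_bigr do rewrite E /N mulrBr.
rewrite big_split/= sumrN.
set d := \sum_(i < n) _ * D i s.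
rewrite opprD opprK addrA; congr (_ + _).
under eq_bigr do rewrite /f mulrDr !mulr_sumr.
rewrite big_split/= addrC; congr (_ + _).
  rewrite exchange_big/=; apply: eq_bigr => k _; rewrite mxE mulr_suml.
  by apply: eq_bigr => j _; rewrite mulrA.
rewrite exchange_big/= -sumrN; apply: eq_bigr => l _.
rewrite mulNr opprK mulr_suml; apply: eq_bigr => j _; exact: mulrA.
Qed.

(** Z stands for the noise and is only sampled at grid points, while N is
    integrated in time.  Summation by parts writes the Riemann-Stieltjes sum of phi against Z as the boundary
    term phi t Z t minus integrals of phi' against Z frozen at the right end of
    each cell; what remains compares Z and N inside the cells. *)
Lemma discretization_error (q : nat) (Z : 'I_n -> R -> R) : (0 < q)%N ->
  (forall j, Z j 0 = 0) ->
  \sum_j phi t 0 j * (D j t + Z j t) -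
    \int[mu]_(s in `[0, t]) (\sum_k (phi s *m B1) 0 k * u k s) -
    \sum_(i < q) \sum_j phi (grid t q i) 0 j *
      (Z j (grid t q i.+1) - Z j (grid t q i)) =
  \sum_j \sum_(i < q) \int[mu]_(s in `[grid t q i, grid t q i.+1])
    (phi' s 0 j * (Z j (grid t q i.+1) - N j s)).
Proof.
move=> q0 Z0.
under eq_bigr do rewrite mulrDr.
rewrite big_split/= variation_of_constants.
rewrite [X in _ - X = _]exchange_big/=.
transitivity (\sum_j phi t 0 j * Z j t -
  \sum_j \sum_(i < q) phi (grid t q i) 0 j *
    (Z j (grid t q i.+1) - Z j (grid t q i)) -
  \sum_j \int[mu]_(s in `[0, t]) (phi' s 0 j * N j s)); first by ring.
rewrite -!sumrB; apply: eq_bigr => j _.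
rewrite (Rintegral_grid t0 q0); last first.
  by apply: continuous_mul_integrable => //; exact: backward'_cont.
have -> : phi t 0 j * Z j t = \sum_(i < q) (phi (grid t q i.+1) 0 j * Z j (grid t q i.+1)
     - phi (grid t q i) 0 j * Z j (grid t q i)).
  rewrite -(big_mkord xpredT (fun i => phi (grid t q i.+1) 0 j * Z j (grid t q i.+1)
     - phi (grid t q i) 0 j * Z j (grid t q i))).
  rewrite (telescope_sumr (fun i => phi (grid t q i) 0 j * Z j (grid t q i)))//.
  by rewrite grid0 gridn// Z0 mulr0 subr0.
rewrite -!sumrB; apply: eq_bigr => i _.
have gi := grid_ge0 q i t0.
have gle : grid t q i.+1 <= t by exact: grid_le.
have gS := le_grid q t0 (leqnSn i).
under [RHS]eq_Rintegral do rewrite mulrBr.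
have i1 : mu.-integrable `[grid t q i, grid t q i.+1]
    (EFin \o (fun s => phi' s 0 j)).
  exact/continuous_integrable/backward'_cont.
rewrite RintegralB//; last 2 first.
- apply: continuous_integrable => s.
  by apply: cvgM; [exact: backward'_cont|exact: cvg_cst].
- apply: (integrable_sub_itv gi gle).
  by apply: continuous_mul_integrable => //; exact: backward'_cont.
rewrite RintegralZr//.
rewrite (Rintegral_FTC gS (@backward'_cont c A t j) (is_derive_backward c A t j)).
rewrite -/phi; ring.
Qed.

End path.
End backward.

(** * Tonelli's theorem over time and probability *)

Section time_omega.
Context {R : realType} d (Omega : measurableType d) (P : probability Omega R).
Notation mu := (@lebesgue_measure R).
Implicit Types g : measurableTypeR R * Omega -> R.

(** Restricting the time to [a, b] by a factor in the integrand makes the domain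
    of integration the full product space. *)
Let cut g a b (z : measurableTypeR R * Omega) : R :=
  if (a <= z.1) && (z.1 <= b) then g z else 0.

Let measurable_cut g a b : measurable_fun setT g -> measurable_fun setT (cut g a b).
Proof.
move=> mg; apply: measurable_fun_ifT => //.
by apply: measurable_and; apply: measurable_fun_ler => //; exact: measurable_fst.
Qed.

Let cutE g a b w : (fun s => g (s, w)) \_ `[a, b] = fun s => cut g a b (s, w).
Proof. by apply/funext => s; rewrite patchE mem_setE in_itv/= /cut. Qed.

Let cutEF g a b w s :
  ((fun s => (g (s, w))%:E) \_ `[a, b]) s = (cut g a b (s, w))%:E.
Proof. by rewrite patchE mem_setE in_itv/= /cut/=; case: ifP. Qed.

Lemma measurable_itv_Rintegral g a b : measurable_fun setT g ->
  measurable_fun setT (fun w => \int[mu]_(s in `[a, b]) g (s, w)).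
Proof.
move=> mg; under eq_fun do rewrite Rintegral_mkcond cutE.
apply: (@measurable_param_Rintegral R _ Omega _ (measurableTypeR R) mu
  (fun z => cut g a b (z.2, z.1))).
by apply: measurableT_comp; [exact: measurable_cut|exact: measurable_swap].
Qed.

Lemma measurable_itv_integral g a b : measurable_fun setT g -> (forall z, 0 <= g z) ->
  measurable_fun setT (fun w => \int[mu]_(s in `[a, b]) (g (s, w))%:E)%E.
Proof.
move=> mg g0.
rewrite (_ : (fun w => _) = fun w => (\int[mu]_s (cut g a b (s, w))%:E)%E); last first.
  apply/funext => w; rewrite integral_mkcond; apply: eq_integral => s _.
  exact: cutEF.
apply: (@measurable_fun_fubini_tonelli_G _ _ (measurableTypeR R) Omega R mu
  (fun z => (cut g a b z)%:E)).
  by apply/measurable_EFinP; exact: measurable_cut.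
by move=> z; rewrite lee_fin /cut; case: ifP.
Qed.

Lemma Tonelli_itv g a b : measurable_fun setT g -> (forall z, 0 <= g z) ->
  (\int[P]_w \int[mu]_(s in `[a, b]) (g (s, w))%:E =
   \int[mu]_(s in `[a, b]) \int[P]_w (g (s, w))%:E)%E.
Proof.
move=> mg g0.
have c0 z : (0 <= (cut g a b z)%:E)%E by rewrite lee_fin /cut; case: ifP.
have mc : measurable_fun setT (fun z => (cut g a b z)%:E).
  by apply/measurable_EFinP; exact: measurable_cut.
have := @fubini_tonelli _ _ (measurableTypeR R) Omega R mu P _ mc c0 => E.
transitivity (\int[P]_w \int[mu]_s (cut g a b (s, w))%:E)%E.
  apply: eq_integral => w _; rewrite integral_mkcond; apply: eq_integral => s _.
  exact: cutEF.
rewrite -E [RHS]integral_mkcond; apply: eq_integral => s _.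
rewrite patchE mem_setE in_itv/= /cut/=.
by case: ifP => // _; rewrite integral0.
Qed.

Lemma Tonelli_itv_le g a b (C : R) : a <= b -> measurable_fun setT g ->
  (forall z, 0 <= g z) -> 0 <= C ->
  (forall s, a <= s <= b -> (\int[P]_w (g (s, w))%:E <= C%:E)%E) ->
  (\int[P]_w \int[mu]_(s in `[a, b]) (g (s, w))%:E <= (C * (b - a))%:E)%E.
Proof.
move=> ab mg g0 C0 H; rewrite Tonelli_itv//.
have mP : measurable_fun setT (fun s : measurableTypeR R => \int[P]_w (g (s, w))%:E)%E.
  apply: (@measurable_fun_fubini_tonelli_F _ _ (measurableTypeR R) Omega R P
    (fun z => (g z)%:E)) => //; exact/measurable_EFinP.
apply: (@le_trans _ _ (\int[mu]_(s in `[a, b]) (cst C%:E) s)%E).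
  apply: ge0_le_integral => //.
  - by move=> s _; apply: integral_ge0 => w _; rewrite lee_fin.
  - exact: measurable_funTS mP.
rewrite integral_cst//= lebesgue_measure_itv/= lte_fin.
case: ltP => [lt|ba]; first by rewrite -EFinB -EFinM.
by rewrite mule0 lee_fin mulr_ge0// subr_ge0.
Qed.

End time_omega.

(** * The control *)

Section control.
Context {R : realType} d (Omega : measurableType d) (P : probability Omega R).
Notation mu := (@lebesgue_measure R).

Lemma ae_lt_pinfty (G : Omega -> \bar R) : measurable_fun setT G ->
  (forall w, 0 <= G w)%E -> (\int[P]_w G w < +oo)%E ->
  {ae P, forall w, (G w < +oo)%E}.
Proof.
move=> mG G0 Gfin.
have iG : P.-integrable setT G.
  apply/integrableP; split => //.
  by rewrite (eq_integral G)// => w _; rewrite gee0_abs.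
apply: filterS (integrable_ae measurableT iG) => w /(_ I).
by rewrite ge0_fin_numE.
Qed.

Variables (F : R -> set_system Omega) (m : nat) (u : R -> Omega -> 'cV[R]_m).
Hypothesis hu : control P F u.

Definition energy t w := (\int[mu]_(s in `[0%R, t]) (frob (u s w) ^+ 2)%:E)%E.

Let U k (z : measurableTypeR R * Omega) := if 0 <= z.1 then u z.1 z.2 k 0 else 0.

Let mU k : measurable_fun setT (U k).
Proof. by apply: jointly_measurable_coord; case: hu. Qed.

Let V z := \sum_k U k z ^+ 2.

Let mV : measurable_fun setT V.
Proof. by apply: measurable_sum => k; exact: measurable_funX. Qed.

Let V0 z : 0 <= V z.
Proof. by rewrite sumr_ge0// => k _; exact: sqr_ge0. Qed.

Let VE s w : 0 <= s -> V (s, w) = frob (u s w) ^+ 2.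
Proof. by move=> s0; rewrite sqr_frob_col /V /U/= s0. Qed.

Lemma energy_ge0 t w : (0 <= energy t w)%E.
Proof. by apply: integral_ge0 => s _; rewrite lee_fin sqr_ge0. Qed.

Lemma measurable_energy t : measurable_fun setT (energy t).
Proof.
rewrite (_ : energy t = fun w => \int[mu]_(s in `[0%R, t]) (V (s, w))%:E)%E.
  exact: measurable_itv_integral.
apply/funext => w; apply: eq_integral => s.
by rewrite mem_setE in_itv/= => /andP[s0 _]; rewrite VE.
Qed.

Lemma energy_fin t : 0 < t -> (\int[P]_w energy t w < +oo)%E.
Proof.
move=> t0; have [_ _ /(_ t t0)] := hu; rewrite /L2T_norm.
have : (0 <= \int[P]_w energy t w)%E.
  by apply: integral_ge0 => w _; exact: energy_ge0.
by rewrite /energy; case: (\int[P]_w _)%E => //= r _ _; exact: ltry.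
Qed.

Lemma energy_le s t w : s <= t -> (energy s w <= energy t w)%E.
Proof.
move=> st; apply: ge0_subset_integral => //.
- apply: (eq_measurable_fun (fun s => (V (s, w))%:E)).
    by move=> r; rewrite mem_setE in_itv/= => /andP[r0 _]; rewrite VE.
  apply/measurable_EFinP; apply: measurable_funTS.
  by apply: (measurableT_comp mV); exact: measurable_pair2.
- by move=> r _; rewrite lee_fin sqr_ge0.
- by apply: subset_itv; rewrite bnd_simp.
Qed.

Lemma control_sqr_integrable t : 0 < t -> {ae P, forall w,
  mu.-integrable `[0, t] (EFin \o (fun s => frob (u s w) ^+ 2))}.
Proof.
move=> t0; apply: filterS (ae_lt_pinfty (measurable_energy t) (energy_ge0 t)
  (energy_fin t0)) => w Gw.
apply/integrableP; split; last first.
  by under eq_integral do rewrite /= ger0_norm ?sqr_ge0//.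
apply: (eq_measurable_fun (fun s => (V (s, w))%:E)).
  by move=> r; rewrite mem_setE in_itv/= => /andP[r0 _]; rewrite VE.
apply/measurable_EFinP; apply: measurable_funTS.
by apply: (measurableT_comp mV); exact: measurable_pair2.
Qed.

Lemma control_integrable t : 0 < t -> {ae P, forall w, forall k,
  mu.-integrable `[0, t] (EFin \o (fun s => u s w k 0))}.
Proof.
move=> t0; apply: filterS (control_sqr_integrable t0) => w iV k.
have i1 : mu.-integrable `[0, t] (EFin \o (fun=> 1 : R)).
  by apply: continuous_integrable => s; exact: cvg_cst.
have i2 := @integrableD _ _ _ mu _ (measurable_itv `[0, t]) _ _ i1 iV.
apply: (@le_integrable _ _ _ mu _ (measurable_itv `[0, t]) _ _ _ _ i2).
  apply: (eq_measurable_fun (fun s => (U k (s, w))%:E)).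
    by move=> r; rewrite mem_setE in_itv/= => /andP[r0 _]; rewrite /U/= r0.
  apply/measurable_EFinP; apply: measurable_funTS.
  by apply: (measurableT_comp (mU k)); exact: measurable_pair2.
move=> s _; rewrite /= lee_fin [leRHS]ger0_norm ?addr_ge0 ?sqr_ge0//.
apply: (@le_trans _ _ (1 + u s w k 0 ^+ 2)).
  rewrite -(real_normK (num_real (u s w k 0))).
  have := sqr_ge0 (`|u s w k 0| - 1); have := sqr_ge0 `|u s w k 0|.
  by rewrite sqrrB1; lra.
rewrite lerD2l sqr_frob_col (bigD1 k)//= lerDl.
by rewrite sumr_ge0// => l _; exact: sqr_ge0.
Qed.

End control.

(** * The output of one system *)

(** The contribution of the control to the output c x at time t. *)
Definition drive {R : realType} {Omega : Type} n m1 (c : 'rV[R]_n)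
    (A : 'M[R]_n) (B1 : 'M[R]_(n, m1)) (u : R -> Omega -> 'cV[R]_m1) (t : R)
    (w : Omega) : R :=
  \int[@lebesgue_measure R]_(s in `[0, t])
    (backward c A t s *m B1 *m u s w) 0 0.

(** The left-point sum, over a grid with q cells, for the stochastic integral of
    c exp ((t - s) A) B2 against M: the contribution of the noise to c x t. *)
Definition noise {R : realType} {Omega : Type} n m2 (c : 'rV[R]_n)
    (A : 'M[R]_n) (B2 : 'M[R]_(n, m2)) (M : R -> Omega -> 'cV[R]_m2) (t : R)
    (q : nat) (w : Omega) : R :=
  \sum_(i < q) (backward c A t (grid t q i) *m B2 *m
    (M (grid t q i.+1) w - M (grid t q i) w)) 0 0.

Section system.
Context {R : realType} d (Omega : measurableType d) (P : probability Omega R).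
Notation mu := (@lebesgue_measure R).
Variables (F : R -> set_system Omega) (n m1 m2 : nat)
  (A : 'M[R]_n) (B1 : 'M[R]_(n, m1)) (B2 : 'M[R]_(n, m2))
  (M : R -> Omega -> 'cV[R]_m2) (K : 'M[R]_m2) (u : R -> Omega -> 'cV[R]_m1)
  (x : R -> Omega -> 'cV[R]_n).
Hypotheses (hF : usual_filtration P F) (hL : levy_process P F M)
  (h2 : square_integrable P M) (h0 : mean_zero P M)
  (hK : covariance_matrix P M K)
  (hu : control P F u) (hx : solution P F A B1 B2 u M x).

(** Jointly measurable versions of the coordinates of the state and the control,
    the drift f, its primitive D, and the remainder N.  For each time s >= 0, N
    agrees almost surely with the noise term Z. *)
Let X j (z : measurableTypeR R * Omega) := if 0 <= z.1 then x z.1 z.2 j 0 else 0.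
Let U k (z : measurableTypeR R * Omega) := if 0 <= z.1 then u z.1 z.2 k 0 else 0.
Let f j z := \sum_l A j l * X l z + \sum_k B1 j k * U k z.
Let D j (z : measurableTypeR R * Omega) := \int[mu]_(r in `[0, z.1]) f j (r, z.2).
Let N j z := X j z - D j z.
Let Z j s w : R := (B2 *m (M s w - M 0 w)) j 0.

Let mX j : measurable_fun setT (X j).
Proof. by apply: jointly_measurable_coord; case: hx. Qed.

Let mU k : measurable_fun setT (U k).
Proof. by apply: jointly_measurable_coord; case: hu. Qed.

Let mf j : measurable_fun setT (f j).
Proof.
by apply: measurable_funD; apply: measurable_sum => l; apply: measurable_funM.
Qed.

Let mD j : measurable_fun setT (D j).
Proof.
pose g (q : (measurableTypeR R * Omega) * measurableTypeR R) : R :=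
  if (0 <= q.2) && (q.2 <= q.1.1) then f j (q.2, q.1.2) else 0.
have mg : measurable_fun setT g.
  apply: measurable_fun_ifT => //.
    apply: measurable_and; apply: measurable_fun_ler => //.
    exact: (measurableT_comp measurable_fst measurable_fst).
  apply: (measurableT_comp (mf j)); apply: measurable_fun_pair.
  - exact: measurable_snd.
  - by apply: measurableT_comp; [exact: measurable_snd|exact: measurable_fst].
have := measurable_param_Rintegral mu mg.
congr measurable_fun; apply/funext => z.
rewrite /D [RHS]Rintegral_mkcond; apply: eq_Rintegral => r _.
by rewrite patchE mem_setE in_itv.
Qed.

Let mN j : measurable_fun setT (N j).
Proof. exact: measurable_funB. Qed.

Let f_drift j s w : 0 <= s -> f j (s, w) = (A *m x s w + B1 *m u s w) j 0.
Proof. by move=> s0; rewrite /f /X /U/= s0 !mxE. Qed.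

Let D_drift j s w : D j (s, w) = \int[mu]_(r in `[0, s]) (A *m x r w + B1 *m u r w) j 0.
Proof.
rewrite /D/=; apply: eq_Rintegral => r.
by rewrite mem_setE in_itv/= => /andP[r0 _]; exact: f_drift.
Qed.

Let N_Z j s : 0 <= s -> {ae P, forall w, N j (s, w) = Z j s w}.
Proof.
move=> s0; have [_ _ _ _ /(_ s s0)] := hx; apply: filterS => w E.
rewrite /N D_drift /X/= s0 [in X in X - _]E mxE mxE [X in X - _]addrC addrK.
by rewrite /Z.
Qed.

Let ZB j s s' w : Z j s' w - Z j s w =
  \sum_l B2 j l * (M s' w l 0 - M s w l 0).
Proof.
rewrite /Z [X in X - _]mxE [X in _ - X]mxE -sumrB; apply: eq_bigr => l _.
by rewrite !mxE; ring.
Qed.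

Let K_ge0 l : 0 <= K l l.
Proof.
have := levy_cov hF hL h2 h0 hK l l ler01 ler01.
rewrite minxx mulr1 => <-; apply: Rintegral_ge0 => w _.
by rewrite -expr2 sqr_ge0.
Qed.

(** Z is 1/2-Hoelder in mean, with this constant. *)
Let cZ j := \sum_l `|B2 j l| * Num.sqrt (K l l).

Let cZ_ge0 j : 0 <= cZ j.
Proof. by rewrite sumr_ge0// => l _; rewrite mulr_ge0 ?sqrtr_ge0. Qed.

Let mZ j s : 0 <= s -> measurable_fun setT (Z j s).
Proof.
move=> s0; rewrite (_ : Z j s = fun w => \sum_l B2 j l * (M s w l 0 - M 0 w l 0)).
  apply: measurable_sum => l; apply: measurable_funM => //.
  by have [] := levy_incr_L2 hF hL h2 l (lexx 0) s0.
by apply/funext => w; rewrite /Z mxE; apply: eq_bigr => l _; rewrite !mxE.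
Qed.

Let E_ZB j s s' h : 0 <= s -> s <= s' -> s' - s <= h ->
  (\int[P]_w `|Z j s' w - Z j s w|%:E <= (cZ j * Num.sqrt h)%:E)%E.
Proof.
move=> s0 ss' sh; have s'0 := le_trans s0 ss'.
have mI l : measurable_fun setT (fun w => M s' w l 0 - M s w l 0).
  by have [] := levy_incr_L2 hF hL h2 l s0 s'0.
apply: (@le_trans _ _ (\int[P]_w
    (\sum_l (`|B2 j l|)%:E * (`|M s' w l 0 - M s w l 0|)%:E))%E).
  apply: ge0_le_integral => //.
  - apply/measurable_EFinP; apply: measurableT_comp => //.
    by apply: measurable_funB; exact: mZ.
  - apply: emeasurable_sum => l; under eq_fun do rewrite -EFinM.
    by apply/measurable_EFinP; apply: measurable_funM => //; exact: measurableT_comp.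
  - move=> w _; under eq_bigr do rewrite -EFinM.
    rewrite sumEFin lee_fin ZB; apply: le_trans (ler_norm_sum _ _ _) _.
    by apply: ler_sum => l _; rewrite normrM.
rewrite ge0_integral_sum//; last first.
  move=> l; under eq_fun do rewrite -EFinM.
  by apply/measurable_EFinP; apply: measurable_funM => //; exact: measurableT_comp.
rewrite /cZ mulr_suml -sumEFin; apply: lee_sum => l _.
rewrite ge0_integralZl_EFin//; last first.
  by apply/measurable_EFinP; exact: measurableT_comp.
rewrite -mulrA EFinM lee_wpmul2l ?lee_fin//.
have iI := integrable_norm (L2_integrable (levy_incr_L2 hF hL h2 l s0 s'0)).
rewrite -(fineK (integrable_fin_num _ iI))// lee_fin.
apply: le_trans (levy_incr_abs hF hL h2 h0 hK l s0 ss') _.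
by rewrite -sqrtrM// ler_sqrt ?ler_wpM2l// mulr_ge0// (le_trans _ sh)// subr_ge0.
Qed.

Let E_N j s s' h : 0 <= s -> s <= s' -> s' - s <= h ->
  (\int[P]_w `|Z j s' w - N j (s, w)|%:E <= (cZ j * Num.sqrt h)%:E)%E.
Proof.
move=> s0 ss' sh; apply: le_trans (E_ZB j s0 ss' sh).
have s'0 := le_trans s0 ss'.
have mNs : measurable_fun setT (fun w => N j (s, w)).
  by apply: (measurableT_comp (mN j)); exact: measurable_pair1.
rewrite (@ge0_ae_eq_integral _ _ _ P setT _
  (fun w => `|Z j s' w - Z j s w|%:E)%E)//.
- apply/measurable_EFinP; apply: measurableT_comp => //.
  by apply: measurable_funB => //; exact: mZ.
- apply/measurable_EFinP; apply: measurableT_comp => //.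
  by apply: measurable_funB; exact: mZ.
- by apply: filterS (N_Z j s0) => w -> _.
Qed.

(** N has finite expected L1 norm on [0, t] since for each time it has the same
    absolute mean as Z. *)
Let integrable_N t : 0 <= t ->
  {ae P, forall w, forall j, mu.-integrable `[0, t] (EFin \o (fun s => N j (s, w)))}.
Proof.
move=> t0; apply: filter_forall => j.
have mg : measurable_fun setT (fun z => `|N j z|) by exact: measurableT_comp.
have g0 z : 0 <= `|N j z| by [].
have H s : 0 <= s <= t -> (\int[P]_w `|N j (s, w)|%:E <= (cZ j * Num.sqrt t)%:E)%E.
  move=> /andP[s0 st]; have sub : s - 0 <= t by rewrite subr0.
  apply: le_trans (E_ZB j (lexx 0) s0 sub).
  rewrite (@ge0_ae_eq_integral _ _ _ P setT _
    (fun w => `|Z j s w - Z j 0 w|%:E)%E)//.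
  - apply/measurable_EFinP; apply: measurableT_comp => //.
    by apply: (measurableT_comp (mN j)); exact: measurable_pair1.
  - apply/measurable_EFinP; apply: measurableT_comp => //.
    by apply: measurable_funB; exact: mZ.
  - apply: filterS (N_Z j s0) => w -> _.
    rewrite [Z j 0 w]mxE big1 ?subr0// => l _.
    by rewrite subrr mxE mulr0.
have C0 : 0 <= cZ j * Num.sqrt t by rewrite mulr_ge0 ?sqrtr_ge0.
have fin := le_lt_trans (@Tonelli_itv_le _ _ _ P _ 0 t _ t0 mg g0 C0 H) (ltry _).
have G0 w : (0 <= \int[mu]_(s in `[0%R, t]) `|N j (s, w)|%:E)%E.
  by apply: integral_ge0 => s _; rewrite lee_fin.
apply: filterS (ae_lt_pinfty (measurable_itv_integral 0 t mg g0) G0 fin) => w Gw.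
apply/integrableP; split => //.
apply/measurable_EFinP; apply: measurable_funTS.
by apply: (measurableT_comp (mN j)); exact: measurable_pair2.
Qed.

Let integrable_U t : 0 < t ->
  {ae P, forall w, forall k, mu.-integrable `[0, t] (EFin \o (fun s => U k (s, w)))}.
Proof.
move=> t0; apply: filterS (control_integrable hu t0) => w H k.
apply: eq_integrable (H k) => // s.
by rewrite mem_setE in_itv/= => /andP[s0 _]; rewrite /U/= s0.
Qed.

Let integrable_f t : 0 <= t ->
  {ae P, forall w, forall j, mu.-integrable `[0, t] (EFin \o (fun s => f j (s, w)))}.
Proof.
move=> t0; have [_ _ _ + _] := hx; apply: filterS => w H j.
have := H t j t0; apply: eq_integrable => // s.
by rewrite mem_setE in_itv/= => /andP[s0 _]; rewrite f_drift.
Qed.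

Let drive_U c t w : drive c A B1 u t w =
  \int[mu]_(s in `[0, t]) (\sum_k (backward c A t s *m B1) 0 k * U k (s, w)).
Proof.
apply: eq_Rintegral => s; rewrite mem_setE in_itv/= => /andP[s0 _].
by rewrite mxE; apply: eq_bigr => k _; rewrite /U/= s0.
Qed.

Lemma measurable_drive c t : measurable_fun setT (drive c A B1 u t).
Proof.
rewrite (_ : drive _ _ _ _ _ = fun w => \int[mu]_(s in `[0, t])
    (\sum_k (backward c A t s *m B1) 0 k * U k (s, w))); last first.
  by apply/funext => w; exact: drive_U.
apply: (@measurable_itv_Rintegral _ _ _
  (fun z => \sum_k (backward c A t z.1 *m B1) 0 k * U k z)).
apply: measurable_sum => k; apply: measurable_funM => //.
apply: (@measurableT_comp _ _ _ _ _ _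
  (fun s : measurableTypeR R => (backward c A t s *m B1) 0 k) _ fst).
  apply: continuous_measurable_fun; apply/C1_cont/mulmx_entry_C1 => i j.
    exact: backward_C1.
  exact: C1_cst.
exact: measurable_fst.
Qed.

Lemma measurable_noise c t q : 0 <= t -> measurable_fun setT (noise c A B2 M t q).
Proof.
move=> t0; apply: measurable_sum => i.
under eq_fun do rewrite mxE; apply: measurable_sum => l.
apply: measurable_funM => //; under eq_fun do rewrite mxE mxE.
by have [] := levy_incr_L2 hF hL h2 l (grid_ge0 q i t0) (grid_ge0 q i.+1 t0).
Qed.

Lemma measurable_output (c : 'rV[R]_n) t : 0 <= t ->
  measurable_fun setT (fun w => (c *m x t w) 0 0).
Proof.
move=> t0; under eq_fun do rewrite mxE; apply: measurable_sum => j.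
apply: measurable_funM => //; have [ax _ _ _ _] := hx.
exact: adapted_measurable hF ax t0.
Qed.

(** On almost every path [discretization_error] applies; the derivative phi' is
    bounded on [0, t]. *)
Let error_path (c : 'rV[R]_n) t q L : 0 < t -> (0 < q)%N -> 0 <= L ->
  (forall j s, 0 <= s <= t -> `|backward' c A t s 0 j| <= L) ->
  {ae P, forall w, (`|(c *m x t w) 0 0 - drive c A B1 u t w -
      noise c A B2 M t q w|%:E <=
    \sum_j \sum_(i < q) L%:E * \int[mu]_(s in `[grid t q i, grid t q i.+1])
      `|Z j (grid t q i.+1) w - N j (s, w)|%:E)%E}.
Proof.
move=> t_gt0 q0 L0 HL; have t0 := ltW t_gt0.
have [_ _ _ _ /(_ t t0) hxt] := hx.
apply: filterS3 (filterI hxt (integrable_f t0)) (integrable_U t_gt0) (integrable_N t0).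
move=> w [ext intf] intU intN.
have Z0 j : Z j 0 w = 0.
  by rewrite /Z mxE big1// => l _; rewrite subrr mxE mulr0.
have E := @discretization_error R n m1 c A B1 t (fun j s => X j (s, w))
  (fun k s => U k (s, w)) t0 intf intU intN q (fun j s => Z j s w) q0 Z0.
have -> : (c *m x t w) 0 0 - drive c A B1 u t w - noise c A B2 M t q w =
  \sum_j \sum_(i < q) \int[mu]_(s in `[grid t q i, grid t q i.+1])
    (backward' c A t s 0 j * (Z j (grid t q i.+1) w - N j (s, w))).
  rewrite -E drive_U; congr (_ - _ - _).
    rewrite mxE; apply: eq_bigr => j _; rewrite backward_end; congr (_ * _).
    by rewrite [in LHS]ext mxE mxE -D_drift.
  apply: eq_bigr => i _; rewrite -mulmxA mxE; apply: eq_bigr => j _.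
  by congr (_ * _); rewrite ZB mxE; apply: eq_bigr => l _; rewrite !mxE.
apply: (@le_trans _ _ (\sum_j \sum_(i < q)
    `|\int[mu]_(s in `[grid t q i, grid t q i.+1])
    (backward' c A t s 0 j * (Z j (grid t q i.+1) w - N j (s, w)))|)%:E).
  rewrite lee_fin; apply: le_trans (ler_norm_sum _ _ _) _.
  by apply: ler_sum => j _; exact: ler_norm_sum.
rewrite -sumEFin; apply: lee_sum => j _; rewrite -sumEFin; apply: lee_sum => i _.
have gi := grid_ge0 q i t0.
have gle : grid t q i.+1 <= t by exact: grid_le.
set a := grid t q i in gi *; set b := grid t q i.+1 in gle *.
have iN : mu.-integrable `[a, b] (EFin \o (fun s => N j (s, w))).
  exact: integrable_sub_itv gi gle (intN j).
have ic : mu.-integrable `[a, b] (EFin \o (fun=> Z j b w)).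
  by apply: continuous_integrable => s; exact: cvg_cst.
have iZN := @integrableB _ _ _ mu _ (measurable_itv `[a, b]) _ _ ic iN.
have ip : mu.-integrable `[a, b]
    (EFin \o (fun s => backward' c A t s 0 j * (Z j b w - N j (s, w)))).
  apply: continuous_mul_integrable; first exact: backward'_cont.
  exact: iZN.
have mZN : measurable_fun `[a, b] (fun s => Z j b w - N j (s, w)).
  by apply/measurable_EFinP; exact: measurable_int iZN.
rewrite EFin_normr_Rintegral//.
apply: le_trans (@le_abse_integral _ _ _ mu _ _ (measurable_itv _) (measurable_int _ ip)) _.
rewrite -ge0_integralZl_EFin//; last first.
  by apply/measurable_EFinP; exact: measurableT_comp.
apply: ge0_le_integral => //.
- by apply: measurableT_comp => //; exact: measurable_int ip.
- apply: measurable_funeM; apply/measurable_EFinP; exact: measurableT_comp.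
- move=> s /=; rewrite in_itv/= => /andP[sa sb].
  rewrite lee_fin normrM ler_wpM2r// HL// (le_trans gi sa)/=.
  exact: le_trans sb gle.
Qed.

(** The mean of the error of [error_path] is computed by Tonelli's theorem: inside
    a cell of length t / q the mean variation of the noise is of order the square
    root of t / q. *)
Lemma system_error (c : 'rV[R]_n) t : 0 < t -> exists2 C, 0 <= C &
  forall q, (0 < q)%N ->
  (\int[P]_w `|(c *m x t w) 0 0 - drive c A B1 u t w - noise c A B2 M t q w|%:E
    <= (C * Num.sqrt (t / q%:R))%:E)%E.
Proof.
move=> t_gt0; have t0 := ltW t_gt0.
have [L L0 HL] : exists2 L, 0 <= L & forall j s, 0 <= s <= t ->
    `|backward' c A t s 0 j| <= L.
  (* The sum of the bounds for the coordinates bounds all of them. *)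
  have H j := continuous_bounded t0 (@backward'_cont R n c A t j).
  pose l j := s2val (cid2 (H j)).
  exists (\sum_j l j); first by apply: sumr_ge0 => j _; exact: (s2valP (cid2 (H j))).
  move=> j s st; apply: le_trans ((s2valP' (cid2 (H j))) s st) _.
  rewrite [leRHS](bigD1 j)//= lerDl sumr_ge0// => k _.
  exact: (s2valP (cid2 (H k))).
exists (L * (\sum_j cZ j) * t).
  by rewrite !mulr_ge0// sumr_ge0.
move=> q q0.
have mg j b : 0 <= b -> measurable_fun setT
    (fun z : measurableTypeR R * Omega => `|Z j b z.2 - N j z|).
  move=> b0; apply: measurableT_comp => //; apply: measurable_funB => //.
  by apply: (measurableT_comp (mZ j b0)); exact: measurable_snd.
have g0 j b (z : measurableTypeR R * Omega) : 0 <= `|Z j b z.2 - N j z| by [].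
have gq i : 0 <= grid t q i by exact: grid_ge0.
have mG j i := measurable_itv_integral (grid t q i) (grid t q i.+1)
  (mg j _ (gq i.+1)) (g0 j (grid t q i.+1)).
have G0 j (i : nat) w : (0 <= \int[mu]_(s in `[grid t q i, grid t q i.+1])
      `|Z j (grid t q i.+1) w - N j (s, w)|%:E)%E.
  by apply: integral_ge0 => s _; rewrite lee_fin.
apply: (@le_trans _ _ (\int[P]_w
   \sum_j \sum_(i < q) L%:E * \int[mu]_(s in `[grid t q i, grid t q i.+1])
      `|Z j (grid t q i.+1) w - N j (s, w)|%:E)%E).
  apply: ae_ge0_le_integral => //.
  - apply/measurable_EFinP; apply: measurableT_comp => //.
    apply: measurable_funB; last exact: measurable_noise.
    by apply: measurable_funB; [exact: measurable_output|exact: measurable_drive].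
  - move=> w _; apply: sume_ge0 => j _; apply: sume_ge0 => i _.
    by rewrite mule_ge0.
  - apply: emeasurable_sum => j; apply: emeasurable_sum => i.
    by apply: measurable_funeM; exact: mG.
  - by apply: filterS (error_path t_gt0 q0 L0 HL) => w + _.
rewrite ge0_integral_sum//; last 2 first.
- by move=> j; apply: emeasurable_sum => i; apply: measurable_funeM; exact: mG.
- by move=> j w _; apply: sume_ge0 => i _; rewrite mule_ge0.
have -> : L * (\sum_j cZ j) * t * Num.sqrt (t / q%:R) =
  \sum_j \sum_(i < q) L * (cZ j * Num.sqrt (t / q%:R) * (t / q%:R)).
  under [RHS]eq_bigr do rewrite sumr_const card_ord.
  rewrite mulr_sumr !mulr_suml; apply: eq_bigr => j _.
  by rewrite -mulr_natr; field; rewrite pnatr_eq0 -lt0n.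
rewrite -sumEFin; apply: lee_sum => j _.
rewrite ge0_integral_sum//; last 2 first.
- by move=> i; apply: measurable_funeM; exact: mG.
- by move=> i w _; rewrite mule_ge0.
rewrite -sumEFin; apply: lee_sum => i _.
rewrite ge0_integralZl_EFin//.
rewrite EFinM lee_wpmul2l// -[X in (_ * X)%R](gridS t q i).
apply: (@Tonelli_itv_le _ _ _ P (fun z => `|Z j (grid t q i.+1) z.2 - N j z|) _ _
  (cZ j * Num.sqrt (t / q%:R))) => //.
- exact: le_grid.
- exact: mg.
- by rewrite mulr_ge0 ?sqrtr_ge0.
- move=> s /andP[s1 s2]; apply: E_N => //; first exact: le_trans s1.
  by rewrite -(gridS t q i) lerD2l lerN2.
Qed.

End system.

(** * Real-variable estimates *)

Section estimates.
Context {R : realType}.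
Notation mu := (@lebesgue_measure R).

(** As sqrt al + sqrt ga <= sqrt (2 (al + ga)). *)
Lemma sqrt_add_mul_le (al ga r v m : R) : 0 <= al -> 0 <= ga -> al + ga <= r ->
  0 <= v -> v <= m -> 1 <= m ->
  Num.sqrt al * v + Num.sqrt ga <= Num.sqrt 2 * Num.sqrt r * m.
Proof.
move=> al0 ga0 agr v0 vm m1; have m0 : 0 <= m by lra.
apply: (@le_trans _ _ ((Num.sqrt al + Num.sqrt ga) * m)).
  rewrite mulrDl; apply: lerD; first by rewrite ler_wpM2l// sqrtr_ge0.
  by rewrite ler_peMr// sqrtr_ge0.
rewrite ler_wpM2r// -sqrtrM// -(@ler_pXn2r _ 2) ?nnegrE ?addr_ge0 ?sqrtr_ge0//.
have := sqr_ge0 (Num.sqrt al - Num.sqrt ga).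
rewrite sqrrB sqrrD !sqr_sqrtr//; lra.
Qed.

Lemma le_of_rate (v : \bar R) (X D E : R) :
  (forall q, (0 < q)%N ->
    (v <= (X + D / Num.sqrt q%:R + E / Num.sqrt q%:R)%:E)%E) -> 0 <= D -> 0 <= E ->
  (v <= X%:E)%E.
Proof.
move=> H D0 E0; apply/lee_addgt0Pr => e e0.
(* Large enough for (D + E) / sqrt q to be at most e. *)
pose q := (Num.bound (((D + E) / e) ^+ 2)).+1.
apply: le_trans (H q isT) _; rewrite -EFinD lee_fin -addrA lerD2l -mulrDl.
have q0 : 0 < Num.sqrt (q%:R : R) by rewrite sqrtr_gt0 ltr0n.
rewrite ler_pdivrMr// mulrC -ler_pdivrMr//.
have -> : (D + E) / e = Num.sqrt (((D + E) / e) ^+ 2).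
  by rewrite sqrtr_sqr ger0_norm// divr_ge0 ?addr_ge0// ltW.
rewrite ler_sqrt ?ler0n// ltW// (lt_le_trans (archi_boundP (sqr_ge0 _)))//.
by rewrite ler_nat.
Qed.

Lemma Rintegral_reflection (g : R -> R) t : 0 < t -> continuous g ->
  \int[mu]_(s in `[0, t]) g (t - s) = \int[mu]_(s in `[0, t]) g s.
Proof.
move=> t0 cg.
have dF x : is_derive x (1 : R) (fun s : R => t - s) (-1).
  by apply: is_derive_eq; rewrite add0r mul1r.
have dFE : derive1 (fun s : R => t - s) = cst (-1).
  by apply/funext => x; rewrite derive1E; exact: derive_val.
have cF : continuous (fun s : R => t - s) := is_derive_cont dF.
rewrite /Rintegral; congr fine.
have := @integration_by_substitution_decreasing R (fun s : R => t - s) g 0 t (ltW t0).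
rewrite subrr subr0 dFE => ->.
- by apply: eq_integral => s _; rewrite /= opprK mulr1.
- by move=> a b _ _ ab; rewrite ltrD2l ltrN2.
- by move=> a _; exact: cvg_cst.
- exact: is_cvg_cst.
- exact: is_cvg_cst.
- split; first by move=> a _; have [] := dF a.
    exact/cvg_at_right_filter/cF.
  exact/cvg_at_left_filter/cF.
- exact: continuous_subspaceT.
Qed.

(** Cauchy-Schwarz in time for each row of H, then the squares are summed over the
    rows. *)
Lemma frob_Rintegral_mulmx p m (H : R -> 'M[R]_(p, m)) (v : R -> 'cV[R]_m) t :
  0 <= t -> (forall i j, continuous (fun s => H s i j)) ->
  (forall j, mu.-integrable `[0, t] (EFin \o (fun s => v s j 0))) ->
  mu.-integrable `[0, t] (EFin \o (fun s => frob (v s) ^+ 2)) ->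
  frob (\col_i \int[mu]_(s in `[0, t]) (H s *m v s) i 0) <=
  Num.sqrt (\int[mu]_(s in `[0, t]) frob (H s) ^+ 2) *
  Num.sqrt (\int[mu]_(s in `[0, t]) frob (v s) ^+ 2).
Proof.
move=> t0 cH iv iV.
have cH2 k : continuous (fun s => \sum_j H s k j ^+ 2).
  apply: continuous_big; first exact: add_continuous.
  by move=> j _ s; apply: cvgM; exact: cH.
have iH2 k : mu.-integrable `[0, t] (EFin \o (fun s => \sum_j H s k j ^+ 2)).
  exact: continuous_integrable.
set al := fun k => \int[mu]_(s in `[0, t]) (\sum_j H s k j ^+ 2).
set V := \int[mu]_(s in `[0, t]) frob (v s) ^+ 2.
have V0 : 0 <= V by apply: Rintegral_ge0 => s _; exact: sqr_ge0.
have al0 k : 0 <= al k.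
  by apply: Rintegral_ge0 => s _; rewrite sumr_ge0// => j _; exact: sqr_ge0.
have iHv k : mu.-integrable `[0, t] (EFin \o (fun s => (H s *m v s) k 0)).
  have := @integrable_sum _ _ _ mu _ (measurable_itv `[0, t]) _ (index_enum _) xpredT
    _ (fun j _ => continuous_mul_integrable (cH k j) (iv j)).
  by apply: eq_integrable => // s _; rewrite /= mxE sumEFin.
have row_bound k : `|\int[mu]_(s in `[0, t]) (H s *m v s) k 0| <=
    Num.sqrt (al k) * Num.sqrt V.
  apply: le_sqrt_of_amgm => // l l0.
  rewrite -RintegralZl// -[l^-1 * V]RintegralZl//.
  have i1 := @integrableZl _ _ _ mu _ (measurable_itv `[0, t]) l _ (iH2 k).
  have i2 := @integrableZl _ _ _ mu _ (measurable_itv `[0, t]) l^-1 _ iV.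
  have i3 := @integrable_norm _ _ _ mu _ _ (iHv k).
  rewrite -RintegralD//.
  apply: (@le_trans _ _ (2 * \int[mu]_(s in `[0, t]) `|(H s *m v s) k 0|)).
    by rewrite ler_wpM2l// le_normr_Rintegral.
  rewrite -RintegralZl//; apply: le_Rintegral => //.
  - exact: (@integrableZl _ _ _ mu _ (measurable_itv `[0, t]) 2 _ i3).
  - exact: (@integrableD _ _ _ mu _ (measurable_itv `[0, t]) _ _ i1 i2).
  move=> s _; rewrite sqr_frob_col !mulr_sumr -big_split/= mxE.
  apply: (@le_trans _ _ (2 * \sum_j `|H s k j * v s j 0|)).
    by rewrite ler_wpM2l// ler_norm_sum.
  rewrite mulr_sumr; apply: ler_sum => j _.
  rewrite -(real_normK (num_real (H s k j))) -(real_normK (num_real (v s j 0))).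
  rewrite normrM -subr_ge0.
  have -> : l * `|H s k j| ^+ 2 + l^-1 * `|v s j 0| ^+ 2 -
      2 * (`|H s k j| * `|v s j 0|) = l^-1 * (l * `|H s k j| - `|v s j 0|) ^+ 2.
    by field; rewrite gt_eqF.
  by rewrite mulr_ge0 ?sqr_ge0// invr_ge0 ltW.
apply: frob_le_sqr; first by rewrite mulr_ge0 ?sqrtr_ge0.
have eal : \int[mu]_(s in `[0, t]) frob (H s) ^+ 2 = \sum_k al k.
  under eq_Rintegral do rewrite sqr_frob.
  rewrite /al; elim: (index_enum _) => [|k r IH].
    under eq_Rintegral do rewrite big_nil.
    by rewrite Rintegral_cst// mul0r big_nil.
  under eq_Rintegral do rewrite big_cons.
  rewrite big_cons RintegralD// ?IH//.
  have := @integrable_sum _ _ _ mu _ (measurable_itv `[0, t]) _ r xpredT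
    _ (fun j _ => iH2 j).
  by apply: eq_integrable => // s _; rewrite /= sumEFin.
rewrite eal exprMn !sqr_sqrtr ?sumr_ge0// mulr_suml.
apply: ler_sum => k _; rewrite big_ord1 mxE.
rewrite -[leRHS]sqr_sqrtr ?mulr_ge0// sqrtrM// -real_normK ?num_real//.
by rewrite ler_pXn2r ?nnegrE ?mulr_ge0 ?sqrtr_ge0.
Qed.

(** This is the trace of G K G^T, because S S^T = K. *)
Lemma sqr_frob_mul_sqrt p m (G : 'M[R]_(p, m)) (S K : 'M[R]_m) : psd_sqrt S K ->
  frob (G *m S) ^+ 2 = \sum_k \sum_l \sum_l' G k l * K l l' * G k l'.
Proof.
move=> [[symS _] SK]; rewrite sqr_frob; apply: eq_bigr => k _.
have -> : \sum_j (G *m S) k j ^+ 2 = (G *m S *m (G *m S)^T) k k.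
  by rewrite [RHS]mxE; apply: eq_bigr => j _; rewrite [X in _ = _ * X]mxE expr2.
rewrite trmx_mul symS mulmxA -(mulmxA G) SK mxE.
rewrite exchange_big/=; apply: eq_bigr => l _.
by rewrite mxE mulr_suml; apply: eq_bigr => l' _; rewrite mxE.
Qed.

End estimates.

(** * Comparison of the two systems *)

Lemma measurable_frob {R : realType} d (T : measurableType d) p q
    (X : T -> 'M[R]_(p, q)) :
  (forall i j, measurable_fun setT (fun w => X w i j)) ->
  measurable_fun setT (fun w => frob (X w)).
Proof.
move=> mX; have ms : measurable_fun [set: R] (@Num.sqrt R).
  by apply: continuous_measurable_fun; exact: sqrt_continuous.
apply: (measurableT_comp ms).
by apply: measurable_sum => i; apply: measurable_sum => j; exact: measurable_funX.
Qed.

Lemma C1_sqr_frob {R : realType} p m (H : R -> 'M[R]_(p, m)) :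
  (forall i j, C1 (fun s => H s i j)) -> C1 (fun s => frob (H s) ^+ 2).
Proof.
move=> H1; under eq_fun do rewrite sqr_frob.
by apply: C1_sum => i; apply: C1_sum => j; exact: C1M.
Qed.

Section comparison.
Context {R : realType} d (Omega : measurableType d) (P : probability Omega R).
Notation mu := (@lebesgue_measure R).
Variables (F : R -> set_system Omega) (n m1 m2 p r : nat)
  (A : 'M[R]_n) (B1 : 'M[R]_(n, m1)) (B2 : 'M[R]_(n, m2)) (C : 'M[R]_(p, n))
  (Ah : 'M[R]_r) (B1h : 'M[R]_(r, m1)) (B2h : 'M[R]_(r, m2))
  (Ch : 'M[R]_(p, r))
  (M : R -> Omega -> 'cV[R]_m2) (K sqrtK : 'M[R]_m2)
  (u : R -> Omega -> 'cV[R]_m1)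
  (x : R -> Omega -> 'cV[R]_n) (xh : R -> Omega -> 'cV[R]_r).
Hypotheses (hF : usual_filtration P F) (hL : levy_process P F M)
  (h2 : square_integrable P M) (h0 : mean_zero P M)
  (hK : covariance_matrix P M K) (hS : psd_sqrt sqrtK K)
  (hu : control P F u) (hx : solution P F A B1 B2 u M x)
  (hxh : solution P F Ah B1h B2h u M xh).

(** The difference of the two impulse responses. *)
Definition impulse_diff m (B : 'M[R]_(n, m)) (Bh : 'M[R]_(r, m)) (s : R) :=
  C *m expmx (s *: A) *m B - Ch *m expmx (s *: Ah) *m Bh.

Lemma impulse_diff_C1 m (B : 'M[R]_(n, m)) (Bh : 'M[R]_(r, m)) i j :
  C1 (fun s => impulse_diff B Bh s i j).
Proof.
have E q (D : 'M[R]_q) (C' : 'M[R]_(p, q)) (B' : 'M[R]_(q, m)) :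
    C1 (fun s => (C' *m expmx (s *: D) *m B') i j).
  apply: mulmx_entry_C1 => k l; last exact: C1_cst.
  by apply: mulmx_entry_C1 => a b; [exact: C1_cst|exact: expmx_C1].
under eq_fun do rewrite [impulse_diff _ _ _ _ _]mxE [X in _ + X]mxE.
by apply: C1D; [exact: E|apply/C1N/E].
Qed.

Let impulse_diff_row m (B : 'M[R]_(n, m)) (Bh : 'M[R]_(r, m)) t s k (v : 'cV[R]_m) :
  (backward (row k C) A t s *m B *m v) 0 0 -
  (backward (row k Ch) Ah t s *m Bh *m v) 0 0 =
  (impulse_diff B Bh (t - s) *m v) k 0.
Proof.
rewrite /impulse_diff /backward mulmxBl [RHS]mxE [X in _ = _ + X]mxE.
by rewrite -!row_mul !mxE; congr (_ - _); apply: eq_bigr => l _; rewrite [X in X * _ = _]mxE.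
Qed.

Let drive_integrand q (D : 'M[R]_q) (B : 'M[R]_(q, m1)) (c : 'rV[R]_q) t w :
  (forall k, mu.-integrable `[0, t] (EFin \o (fun s => u s w k 0))) ->
  mu.-integrable `[0, t]
    (EFin \o (fun s => (backward c D t s *m B *m u s w) 0 0)).
Proof.
move=> iu.
have cB k : continuous (fun s => (backward c D t s *m B) 0 k).
  apply/C1_cont/mulmx_entry_C1 => i j; first exact: backward_C1.
  exact: C1_cst.
have := @integrable_sum _ _ _ mu _ (measurable_itv `[0, t]) _ (index_enum _) xpredT
  _ (fun k _ => continuous_mul_integrable (cB k) (iu k)).
by apply: eq_integrable => // s _; rewrite /= [in RHS]mxE sumEFin.
Qed.

Let drive_diff t w : 'cV[R]_p := \col_k (drive (row k C) A B1 u t w - drive (row k Ch) Ah B1h u t w).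

Let noise_diff t q w : 'cV[R]_p :=
  \col_k (noise (row k C) A B2 M t q w - noise (row k Ch) Ah B2h M t q w).

Let drive_gain t := \int[mu]_(s in `[0, t]) frob (impulse_diff B1 B1h s) ^+ 2.
Let noise_gain t := \int[mu]_(s in `[0, t]) frob (impulse_diff B2 B2h s *m sqrtK) ^+ 2.

Let measurable_drive_diff t : measurable_fun setT (fun w => frob (drive_diff t w)).
Proof.
apply: measurable_frob => k l; under eq_fun do rewrite mxE.
by apply: measurable_funB; exact: measurable_drive hu _ _.
Qed.

(** Cauchy-Schwarz in time on each path, then in probability. *)
Let drive_bound t : 0 < t ->
  (\int[P]_w (frob (drive_diff t w))%:E <=
   (Num.sqrt (drive_gain t) * Num.sqrt (fine (\int[P]_w energy u t w)))%:E)%E.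
Proof.
move=> t_gt0; have t0 := ltW t_gt0.
have dg0 : 0 <= drive_gain t by apply: Rintegral_ge0 => s _; exact: sqr_ge0.
have e0 : (0 <= \int[P]_w energy u t w)%E.
  by apply: integral_ge0 => w _; exact: energy_ge0.
have efin : (\int[P]_w energy u t w)%E \is a fin_num.
  by rewrite ge0_fin_numE//; exact: energy_fin hu t t_gt0.
have path : {ae P, forall w, forall l : R, 0 < l ->
    ((frob (drive_diff t w))%:E <= (2^-1 * l * drive_gain t)%:E + (2^-1 * l^-1)%:E * energy u t w)%E}.
  apply: filterS2 (control_integrable hu t_gt0) (control_sqr_integrable hu t_gt0).
  move=> w iu iu2 l l0.
  have cG : forall i j, continuous (fun s => impulse_diff B1 B1h (t - s) i j).
    move=> i j; apply: C1_cont.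
    exact: (@C1_refl _ t (fun s => impulse_diff B1 B1h s i j) (impulse_diff_C1 _ _ _ _)).
  have ea : drive_diff t w = \col_k \int[mu]_(s in `[0, t])
      (impulse_diff B1 B1h (t - s) *m u s w) k 0.
    apply/colP => k; rewrite !mxE /drive -RintegralB//.
    - by apply: eq_Rintegral => s _; exact: impulse_diff_row.
    - exact: drive_integrand.
    - exact: drive_integrand.
  have := frob_Rintegral_mulmx t0 cG iu iu2.
  have -> : \int[mu]_(s in `[0, t]) frob (impulse_diff B1 B1h (t - s)) ^+ 2 = drive_gain t.
    apply: (Rintegral_reflection t_gt0 (g := fun s => frob (impulse_diff B1 B1h s) ^+ 2)).
    by apply/C1_cont/C1_sqr_frob => i j; exact: impulse_diff_C1.
  rewrite -ea => H; rewrite /energy.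
  set V := \int[mu]_(s in `[0, t]) frob (u s w) ^+ 2 in H.
  have eV : (\int[mu]_(s in `[0%R, t]) (frob (u s w) ^+ 2)%:E = V%:E)%E.
    by rewrite /V /Rintegral fineK//; exact: integrable_fin_num.
  rewrite eV -EFinM -EFinD lee_fin; apply: le_trans H _.
  have V0 : 0 <= V by apply: Rintegral_ge0 => s _; exact: sqr_ge0.
  rewrite -{2}(sqr_sqrtr dg0) -{2}(sqr_sqrtr V0) -subr_ge0.
  have -> : 2^-1 * l * Num.sqrt (drive_gain t) ^+ 2 + 2^-1 * l^-1 * Num.sqrt V ^+ 2 -
    Num.sqrt (drive_gain t) * Num.sqrt V =
    2^-1 * l^-1 * (l * Num.sqrt (drive_gain t) - Num.sqrt V) ^+ 2.
    by field; rewrite gt_eqF.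
  by rewrite mulr_ge0 ?sqr_ge0// mulr_ge0// invr_ge0 ltW.
have fin (l : R) : 0 < l -> (\int[P]_w (frob (drive_diff t w))%:E <=
    (2^-1 * (l * drive_gain t + l^-1 * fine (\int[P]_w energy u t w)))%:E)%E.
  move=> l0; have l'0 : 0 <= 2^-1 * l^-1 :> R by rewrite mulr_ge0// invr_ge0 ltW.
  have la0 : 0 <= 2^-1 * l * drive_gain t by rewrite !mulr_ge0// ltW.
  have me := measurable_energy hu t.
  apply: (@le_trans _ _ (\int[P]_w
      ((2^-1 * l * drive_gain t)%:E + (2^-1 * l^-1)%:E * energy u t w))%E).
    apply: ae_ge0_le_integral => //.
    - by move=> w _; rewrite lee_fin frob_ge0.
    - exact/measurable_EFinP/measurable_drive_diff.
    - by move=> w _; rewrite adde_ge0// mule_ge0// energy_ge0.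
    - by apply: emeasurable_funD => //; exact: measurable_funeM.
    - by apply: filterS path => w H _; exact: H.
  rewrite ge0_integralD//; last 2 first.
  - by move=> w _; rewrite mule_ge0// energy_ge0.
  - exact: measurable_funeM.
  rewrite integral_cst// [X in (_ * X + _)%E](probability_setT P) mule1.
  rewrite ge0_integralZl_EFin//; last by move=> w _; exact: energy_ge0.
  by rewrite -[X in (_ + _ * X)%E](fineK efin) -EFinM -EFinD lee_fin mulrDr !mulrA.
have ffin : (\int[P]_w (frob (drive_diff t w))%:E)%E \is a fin_num.
  rewrite ge0_fin_numE; first exact: le_lt_trans (fin 1 ltr01) (ltry _).
  by apply: integral_ge0 => w _; rewrite lee_fin frob_ge0.
rewrite -(fineK ffin) lee_fin; apply: le_sqrt_of_amgm => //; first exact: fine_ge0.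
move=> l l0; have := fin l l0; rewrite -{1}(fineK ffin) lee_fin; lra.
Qed.

Let noise_sum t q k w : noise_diff t q w k 0 = \sum_(i < q) \sum_l
  impulse_diff B2 B2h (t - grid t q i) k l *
    (M (grid t q i.+1) w l 0 - M (grid t q i) w l 0).
Proof.
rewrite mxE /noise -sumrB; apply: eq_bigr => i _.
rewrite impulse_diff_row mxE; apply: eq_bigr => l _.
by congr (_ * _); rewrite !mxE.
Qed.

Let noise_L2 t q k : 0 <= t -> L2 P (fun w => noise_diff t q w k 0).
Proof.
move=> t0; under eq_fun do rewrite noise_sum.
apply: L2_sum => i; apply: L2_sum => l; apply: L2Z.
by apply: (levy_incr_L2 hF hL h2); exact: grid_ge0.
Qed.

(** The mean norm is at most the root mean square, which [levy_sum_sqr] computes. *)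
Let noise_bound t q : 0 <= t ->
  (\int[P]_w (frob (noise_diff t q w))%:E <= (Num.sqrt (\sum_(i < q) t / q%:R *
     frob (impulse_diff B2 B2h (t - grid t q i) *m sqrtK) ^+ 2))%:E)%E.
Proof.
move=> t0.
have iS k : P.-integrable setT (EFin \o (fun w => noise_diff t q w k 0 ^+ 2)).
  by have [] := noise_L2 q k t0.
have LS : L2 P (fun w => frob (noise_diff t q w)).
  split.
    by apply: measurable_frob => i j; rewrite ord1; have [] := noise_L2 q i t0.
  have := @integrable_sum _ _ _ P _ measurableT _ (index_enum _) xpredT _ (fun k _ => iS k).
  by apply: eq_integrable => // w _; rewrite /= sqr_frob_col sumEFin.
have iN := L2_integrable LS.
rewrite -(fineK (integrable_fin_num measurableT iN)) lee_fin.
have := Rintegral_norm_le_sqrt LS.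
under eq_Rintegral do rewrite ger0_norm ?frob_ge0//.
move=> H; apply: le_trans H _.
apply: ler_wsqrtr; under eq_Rintegral do rewrite sqr_frob_col.
rewrite Rintegral_sum//.
under eq_bigr => k _.
  under eq_Rintegral do rewrite noise_sum.
  rewrite (levy_sum_sqr hF hL h2 h0 hK (fun i l => impulse_diff B2 B2h (t - grid t q i) k l) t0).
  over.
rewrite exchange_big/=; apply: ler_sum => i _.
rewrite (sqr_frob_mul_sqrt _ hS) mulr_sumr.
by apply: ler_sum => k _.
Qed.

Lemma output_measurable t : 0 <= t ->
  measurable_fun setT (fun w => frob (C *m x t w - Ch *m xh t w)).
Proof.
move=> t0; apply: measurable_frob => k l; rewrite ord1.
under eq_fun do rewrite mxE [X in _ + X]mxE; apply: measurable_funB.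
  have := measurable_output hF hx (row k C) t0; congr measurable_fun.
  by apply/funext => w; rewrite !mxE; apply: eq_bigr => j _; rewrite mxE.
have := measurable_output hF hxh (row k Ch) t0; congr measurable_fun.
by apply/funext => w; rewrite !mxE; apply: eq_bigr => j _; rewrite mxE.
Qed.

(** For every q the output error is the sum of the drive difference, the noise
    difference and an error of mean O(q^-1/2); the Riemann sum bounding the
    noise difference converges at the rate O(1/q), and q is arbitrary. *)
Lemma fixed_time_bound t : 0 < t ->
  (\int[P]_w (frob (C *m x t w - Ch *m xh t w))%:E <=
   (Num.sqrt (\int[mu]_(s in `[0, t]) frob (impulse_diff B1 B1h s) ^+ 2) *
      Num.sqrt (fine (\int[P]_w energy u t w)) +
    Num.sqrt (\int[mu]_(s in `[0, t])
      frob (impulse_diff B2 B2h s *m sqrtK) ^+ 2))%:E)%E.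
Proof.
move=> t_gt0; have t0 := ltW t_gt0; rewrite -/(drive_gain t) -/(noise_gain t).
pose e k q w := (row k C *m x t w) 0 0 - drive (row k C) A B1 u t w -
  noise (row k C) A B2 M t q w.
pose eh k q w := (row k Ch *m xh t w) 0 0 - drive (row k Ch) Ah B1h u t w -
  noise (row k Ch) Ah B2h M t q w.
have H k := system_error hF hL h2 h0 hK hu hx (row k C) t_gt0.
have Hh k := system_error hF hL h2 h0 hK hu hxh (row k Ch) t_gt0.
pose D k := s2val (cid2 (H k)); pose Dh k := s2val (cid2 (Hh k)).
have D0 k : 0 <= D k := s2valP (cid2 (H k)).
have Dh0 k : 0 <= Dh k := s2valP (cid2 (Hh k)).
have He k q : (0 < q)%N -> (\int[P]_w `|e k q w|%:E <= (D k * Num.sqrt (t / q%:R))%:E)%E.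
  exact: (s2valP' (cid2 (H k))).
have Heh k q : (0 < q)%N -> (\int[P]_w `|eh k q w|%:E <= (Dh k * Num.sqrt (t / q%:R))%:E)%E.
  exact: (s2valP' (cid2 (Hh k))).
have me k q : measurable_fun setT (fun w => `|e k q w|).
  apply: measurableT_comp => //.
  apply: measurable_funB; last exact: measurable_noise hF hL h2 _ _ _ _.
  apply: measurable_funB; first exact: (measurable_output hF hx (row k C) t0).
  exact: measurable_drive hu _ _.
have meh k q : measurable_fun setT (fun w => `|eh k q w|).
  apply: measurableT_comp => //.
  apply: measurable_funB; last exact: measurable_noise hF hL h2 _ _ _ _.
  apply: measurable_funB; first exact: (measurable_output hF hxh (row k Ch) t0).
  exact: measurable_drive hu _ _.
have gC1 i j : C1 (fun s => (impulse_diff B2 B2h s *m sqrtK) i j).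
  apply: mulmx_entry_C1 => k l; first exact: impulse_diff_C1.
  exact: C1_cst.
have [L HL] := Riemann_sum_C1 t0 (C1_refl t (C1_sqr_frob gC1)).
have ng0 : 0 <= noise_gain t by apply: Rintegral_ge0 => s _; exact: sqr_ge0.
apply: (@le_of_rate _ _ _ (Num.sqrt `|L|) ((\sum_k (D k + Dh k)) * Num.sqrt t)).
- move=> q q0.
  have mS : measurable_fun setT (fun w => frob (noise_diff t q w)).
    by apply: measurable_frob => i j; rewrite ord1; have [] := noise_L2 q i t0.
  apply: (@le_trans _ _ (\int[P]_w ((frob (drive_diff t w))%:E + (frob (noise_diff t q w))%:E +
      \sum_k (`|e k q w|%:E + `|eh k q w|%:E)))%E).
    apply: ge0_le_integral => //.
    + by move=> w _; rewrite lee_fin frob_ge0.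
    + by apply/measurable_EFinP; exact: output_measurable.
    + apply: emeasurable_funD.
        by apply: emeasurable_funD; exact/measurable_EFinP.
      apply: emeasurable_sum => k.
      by apply: emeasurable_funD; exact/measurable_EFinP.
    + move=> w _.
      under eq_bigr do rewrite -EFinD.
      rewrite sumEFin -!EFinD lee_fin.
      have -> : C *m x t w - Ch *m xh t w =
          (drive_diff t w + noise_diff t q w) + \col_k (e k q w - eh k q w).
        apply/colP => k; transitivity
          ((row k C *m x t w) 0 0 - (row k Ch *m xh t w) 0 0).
          by rewrite -!row_mul !mxE.
        transitivity ((drive (row k C) A B1 u t w - drive (row k Ch) Ah B1h u t w) +
          (noise (row k C) A B2 M t q w - noise (row k Ch) Ah B2h M t q w) +
          (e k q w - eh k q w)); first by rewrite /e /eh; ring.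
        by rewrite !mxE.
      apply: le_trans (frobD _ _) _; apply: lerD; first exact: frobD.
      apply: le_trans (frob_col_le_sum _) _; apply: ler_sum => k _.
      by rewrite mxE; exact: ler_normB.
  rewrite ge0_integralD//; last 4 first.
  + by move=> w _; rewrite adde_ge0// lee_fin frob_ge0.
  + by apply: emeasurable_funD; exact/measurable_EFinP.
  + by move=> w _; apply: sume_ge0 => k _; rewrite adde_ge0.
  + by apply: emeasurable_sum => k; apply: emeasurable_funD; exact/measurable_EFinP.
  rewrite 2!EFinD; apply: leeD.
    rewrite ge0_integralD//; last 4 first.
    + by move=> w _; rewrite lee_fin frob_ge0.
    + exact/measurable_EFinP.
    + by move=> w _; rewrite lee_fin frob_ge0.
    + exact/measurable_EFinP.
    rewrite EFinD -addeA; apply: leeD; first exact: drive_bound.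
    apply: le_trans (noise_bound q t0) _; rewrite -EFinD lee_fin.
    have := HL q q0.
    rewrite (Rintegral_reflection t_gt0 (g := fun s => frob (impulse_diff B2 B2h s *m sqrtK) ^+ 2));
      last exact/C1_cont/C1_sqr_frob.
    move=> HLq; apply: (@le_trans _ _ (Num.sqrt (noise_gain t + `|L| / q%:R))).
      apply: ler_wsqrtr; apply: le_trans HLq _.
      by rewrite lerD2l ler_wpM2r ?invr_ge0// ler_norm.
    rewrite -sqrtrV ?ler0n// -sqrtrM//.
    have Lq : 0 <= `|L| / q%:R by rewrite mulr_ge0 ?invr_ge0.
    rewrite -(@ler_pXn2r _ 2) ?nnegrE ?addr_ge0 ?sqrtr_ge0//.
    rewrite sqrrD !sqr_sqrtr ?addr_ge0// lerD2r lerDl.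
    by rewrite mulrn_wge0// mulr_ge0 ?sqrtr_ge0.
  rewrite ge0_integral_sum//; last 2 first.
  + by move=> k; apply: emeasurable_funD; exact/measurable_EFinP.
  + by move=> k w _; rewrite adde_ge0.
  rewrite -mulrA -sqrtrV ?ler0n// -sqrtrM// mulr_suml -sumEFin.
  apply: lee_sum => k _.
  rewrite ge0_integralD//; [|exact/measurable_EFinP|exact/measurable_EFinP].
  by rewrite mulrDl EFinD; apply: leeD; [exact: He|exact: Heh].
- exact: sqrtr_ge0.
- by rewrite mulr_ge0 ?sqrtr_ge0// sumr_ge0// => k _; rewrite addr_ge0.
Qed.

End comparison.

(** * The weighted norm and the error bound *)

Section weighted_norm.
Context {R : realType} (n m1 m2 p r : nat).
Notation mu := (@lebesgue_measure R).
Variables (A : 'M[R]_n) (B1 : 'M[R]_(n, m1)) (B2 : 'M[R]_(n, m2)) (C : 'M[R]_(p, n))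
  (Ah : 'M[R]_r) (B1h : 'M[R]_(r, m1)) (B2h : 'M[R]_(r, m2))
  (Ch : 'M[R]_(p, r)) (sqrtK : 'M[R]_m2).

Lemma sqr_frob_row_mx m q q' (X : 'M[R]_(m, q)) (Y : 'M[R]_(m, q')) :
  frob (row_mx X Y) ^+ 2 = frob X ^+ 2 + frob Y ^+ 2.
Proof.
rewrite !sqr_frob -big_split/=; apply: eq_bigr => i _.
rewrite big_split_ord/=; congr (_ + _); apply: eq_bigr => j _.
  by rewrite row_mxEl.
by rewrite row_mxEr.
Qed.

Let W : 'M[R]_(m1 + m2) := block_mx 1%:M 0 0 sqrtK.
Let G s := C *m expmx (s *: A) *m row_mx B1 B2 - Ch *m expmx (s *: Ah) *m row_mx B1h B2h.
Notation G1 := (impulse_diff A C Ah Ch B1 B1h).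
Notation G2 := (impulse_diff A C Ah Ch B2 B2h).

Let sqr_frob_weighted s :
  frob (G s *m W) ^+ 2 = frob (G1 s) ^+ 2 + frob (G2 s *m sqrtK) ^+ 2.
Proof.
rewrite /G !mul_mx_row opp_row_mx add_row_mx /W mul_row_block.
by rewrite mulmx1 !mulmx0 addr0 add0r sqr_frob_row_mx.
Qed.

(** The blocks of the weight separate the drive and the noise parts of the impulse
    response. *)
Lemma energy_weighted_le t : 0 <= t ->
  ((\int[mu]_(s in `[0, t]) frob (G1 s) ^+ 2 +
    \int[mu]_(s in `[0, t]) frob (G2 s *m sqrtK) ^+ 2)%:E <=
  \int[mu]_(s in `[0%R, +oo[) (frob (G s *m W) ^+ 2)%:E)%E.
Proof.
move=> t0.
have c1 : continuous (fun s => frob (G1 s) ^+ 2).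
  by apply/C1_cont/C1_sqr_frob => i j; exact: impulse_diff_C1.
have c2 : continuous (fun s => frob (G2 s *m sqrtK) ^+ 2).
  apply/C1_cont/C1_sqr_frob/mulmx_entry_C1 => i j; first exact: impulse_diff_C1.
  exact: C1_cst.
have cG : continuous (fun s => frob (G s *m W) ^+ 2).
  under eq_fun do rewrite sqr_frob_weighted.
  by move=> s; apply: cvgD; [exact: c1|exact: c2].
rewrite -RintegralD//; [|exact: continuous_integrable|exact: continuous_integrable].
under eq_Rintegral do rewrite -sqr_frob_weighted.
rewrite /Rintegral fineK; last exact/integrable_fin_num/continuous_integrable.
apply: ge0_subset_integral => //.
- by apply/measurable_EFinP/measurable_funTS; exact: continuous_measurable_fun.
- by move=> s _; rewrite lee_fin sqr_ge0.
- by apply: subset_itvl; rewrite bnd_simp.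
Qed.

End weighted_norm.

Lemma error_bound_le {R : realType} (al ga : R) (I e eT : \bar R) :
  0 <= al -> 0 <= ga -> ((al + ga)%:E <= I)%E ->
  (0 <= e)%E -> (e <= eT)%E -> (eT < +oo)%E ->
  ((Num.sqrt al * Num.sqrt (fine e) + Num.sqrt ga)%:E <=
    (Num.sqrt 2)%:E * sqrte I * maxe 1 (sqrte eT))%E.
Proof.
move=> al0 ga0 + e0 eeT eTfin.
have eT0 : (0 <= eT)%E by exact: le_trans eeT.
have eTE : eT = (fine eT)%:E by rewrite fineK// ge0_fin_numE.
have eE : e = (fine e)%:E by rewrite fineK// ge0_fin_numE//; exact: le_lt_trans eTfin.
move: eeT; rewrite eTE eE lee_fin /= => eeT.
have sqrt2 : (0 < Num.sqrt 2 :> R) by rewrite sqrtr_gt0.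
(* If I is infinite, so is the right-hand side, as the maximum is at least 1. *)
rewrite -EFin_max; case: I => [i| |]//=; last 1 first.
  move=> _; rewrite gt0_muley ?lte_fin// gt0_mulye ?leey//.
rewrite lee_fin => agi; rewrite -!EFinM lee_fin; apply: sqrt_add_mul_le => //.
- by rewrite le_max ler_wsqrtr ?orbT.
- by rewrite le_max lexx.
Qed.

Unset Implicit Arguments.

Theorem mainTheorem5 (R : realType) (d : measure_display)
  (Omega : measurableType d) (P : probability Omega R)
  (F : R -> set_system Omega) (n m1 m2 p r : nat)
  (A : 'M[R]_n) (B1 : 'M[R]_(n, m1)) (B2 : 'M[R]_(n, m2)) (C : 'M[R]_(p, n))
  (Ah : 'M[R]_r) (B1h : 'M[R]_(r, m1)) (B2h : 'M[R]_(r, m2))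
  (Ch : 'M[R]_(p, r))
  (M : R -> Omega -> 'cV[R]_m2) (K sqrtK : 'M[R]_m2)
  (u : R -> Omega -> 'cV[R]_m1)
  (x : R -> Omega -> 'cV[R]_n) (xh : R -> Omega -> 'cV[R]_r)
  (y yh : R -> Omega -> 'cV[R]_p) :
  usual_filtration P F ->
  levy_process P F M -> square_integrable P M -> mean_zero P M ->
  covariance_matrix P M K -> psd_sqrt sqrtK K ->
  control P F u ->
  solution P F A B1 B2 u M x ->
  (forall (t : R) w, 0 <= t -> y t w = C *m x t w) ->
  solution P F Ah B1h B2h u M xh ->
  (forall (t : R) w, 0 <= t -> yh t w = Ch *m xh t w) ->
  hurwitz A -> hurwitz Ah ->
  let W : 'M[R]_(m1 + m2) := block_mx 1%:M 0 0 sqrtK in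
  forall T : R, 0 < T ->
  (ereal_sup [set 'E_P[fun w => frob (y t w - yh t w)%R] | t in `[0%R, T]]
   <= (Num.sqrt 2)%:E
      * L2norm_weighted
          (fun s => (C *m expmx (s *: A) *m row_mx B1 B2
                     - Ch *m expmx (s *: Ah) *m row_mx B1h B2h)%R) W
      * maxe 1 (L2T_norm P T u))%E.
Proof.
move=> hF hL h2 h0 hK hS hu hx hy hxh hyh _ _ W T T0.
apply: ge_ereal_sup => _ [t t0T <-] /=.
have /andP[t0 tT] : 0 <= t <= T by [].
rewrite unlock.
under eq_integral do rewrite hy// hyh//.
have max0 : (0 < maxe 1 (L2T_norm P T u))%E by rewrite lt_max lte01.
have [t_le0|t_gt0] := leP t 0.
  (* Both states vanish almost surely at time 0. *)
  have {t0 t_le0 tT t0T}t0 : 0 = t by apply/le_anti; rewrite t0.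
  rewrite (@ge0_ae_eq_integral _ _ _ P setT _ (cst 0%E))//.
  - rewrite integral0; apply: mule_ge0; last exact: ltW.
    by apply: mule_ge0; [rewrite lee_fin sqrtr_ge0|exact: sqrte_ge0].
  - by apply/measurable_EFinP; apply: (output_measurable C Ch hF hx hxh); rewrite t0.
  - by move=> w _; rewrite lee_fin frob_ge0.
  - have [_ _ x0 _ _] := hx; have [_ _ xh0 _ _] := hxh.
    apply: filterS2 x0 xh0 => w; rewrite -t0 => -> -> _ /=.
    rewrite !mulmx0 subrr; congr EFin; apply/eqP; rewrite -sqrf_eq0 sqr_frob_col.
    by rewrite big1// => i _; rewrite mxE expr0n.
apply: le_trans (fixed_time_bound C Ch hF hL h2 h0 hK hS hu hx hxh t_gt0) _.
apply: error_bound_le.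
- by apply: Rintegral_ge0 => s _; exact: sqr_ge0.
- by apply: Rintegral_ge0 => s _; exact: sqr_ge0.
- exact: (energy_weighted_le A B1 B2 C Ah B1h B2h Ch sqrtK (ltW t_gt0)).
- by apply: integral_ge0 => w _; exact: energy_ge0.
- apply: ge0_le_integral => //.
  + by move=> w _; exact: energy_ge0.
  + exact: measurable_energy hu t.
  + exact: measurable_energy hu T.
  + by move=> w _; exact: energy_le hu _ _ _ tT.
- exact: (energy_fin hu T0).
Qed.
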